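(* Let $A, B \in \mathbb{P}_{2n}(\mathbb{R})$ and let $1 \leq i_1 < \cdots < i_k \leq n$ be any distinct indices such that $$\sum_{j=1}^{k} d_{i_j}(A+B) = \sum_{j=1}^{k} d_{i_j}(A)+\sum_{j=1}^{k} d_{j}(B).$$ Then there exist a positive integer $r$, $2k$-dimensional symplectic subspaces $\mathscr{U}_1,\ldots,\mathscr{U}_r \subset \mathbb{R}^{2n}$, and real numbers $0=a_0<a_1<\cdots<a_r=1$ satisfying the following conditions: (i) The subspaces $\mathscr{U}_1,\ldots,\mathscr{U}_r$ are invariant under both $JA$ and $JB$. (ii) Each subspace $\mathscr{U}_\ell$, for $\ell=1,\ldots,r$, has a symplectic basis consisting of symplectic eigenvector pairs of $B$ corresponding to the symplectic eigenvalues $d_1(B),\ldots,d_k(B)$. (iii) For each $\ell\in\{1,\ldots,r\}$, there exists a non-trivial subinterval $[b_\ell,c_\ell]\subset[a_{\ell-1},a_\ell]$ such that for all $t\in[b_\ell,c_\ell]$, the symplectic eigenvalues of $A+tB$ associated with $\mathscr{U}_\ell$ are $d_{i_1}(A+tB),\ldots,d_{i_k}(A+tB)$.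
   Context: $\mathbb{P}_{2n}(\mathbb{R})$ is the set of $2n\times 2n$ real symmetric positive definite matrices. $J = \begin{pmatrix} 0 & I_n \\ -I_n & 0\end{pmatrix}$, and $\langle\cdot,\cdot\rangle$ is the Euclidean inner product on $\mathbb{R}^{2n}$. $\operatorname{Sp}(2n)$ is the set of real $2n\times 2n$ matrices $M$ with $M^TJM=J$. By Williamson's theorem, for $A\in\mathbb{P}_{2n}(\mathbb{R})$ there is $M\in\operatorname{Sp}(2n)$ such that $M^TAM = D\oplus D$ with $D$ an $n\times n$ diagonal matrix with positive diagonal entries $d_1(A)\le\cdots\le d_n(A)$; these numbers are uniquely determined by $A$ and are called the symplectic eigenvalues of $A$. A pair $(u,v)$ of non-zero vectors in $\mathbb{R}^{2n}$ is a symplectic eigenvector pair of $A$ corresponding to a symplectic eigenvalue $d$ of $A$ if $Au = d\,Jv$ and $Av = -d\,Ju$. A subspace $\mathscr{U}$ of $\mathbb{R}^{2n}$ is a symplectic subspace if for every non-zero $u\in\mathscr{U}$ there exists $v\in\mathscr{U}$ with $\langle u,Jv\rangle\neq 0$. A symplectic basis of a $2k$-dimensional symplectic subspace $\mathscr{U}$ is a basis $\{u_1,\ldots,u_k,v_1,\ldots,v_k\}$ of $\mathscr{U}$ with $\langle u_i,Jv_i\rangle=1$ for all $i$ and $\langle u_i,Jv_j\rangle=\langle u_i,Ju_j\rangle=\langle v_i,Jv_j\rangle=0$ for all $i\ne j$. In (ii), the basis is of this form with $(u_j,v_j)$ a symplectic eigenvector pair of $B$ corresponding to $d_j(B)$ for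 $j=1,\ldots,k$. For $A\in\mathbb{P}_{2n}(\mathbb{R})$ and a $2k$-dimensional symplectic subspace $\mathscr{U}$ invariant under $JA$, there exists a symplectic basis $\{u_1,\ldots,u_k,v_1,\ldots,v_k\}$ of $\mathscr{U}$ such that $(u_1,v_1),\ldots,(u_k,v_k)$ are symplectic eigenvector pairs of $A$ corresponding to some symplectic eigenvalues $\gamma_1\le\cdots\le\gamma_k$ of $A$; the numbers $\gamma_1,\ldots,\gamma_k$ (listed with multiplicity) are called the symplectic eigenvalues of $A$ associated with $\mathscr{U}$. An interval $[b,c]$ is non-trivial if $b<c$. *)

(* Defs.v *)
From HB Require Import structures.
From mathcomp Require Export all_boot all_order all_algebra.
From mathcomp Require Export all_classical all_reals.
Set Implicit Arguments.
Unset Strict Implicit.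
Unset Printing Implicit Defensive.
Import Order.TTheory GRing.Theory Num.Theory.
Local Open Scope classical_set_scope.
Local Open Scope ring_scope.

Section SymplecticDefs.
Variables (R : realType) (n : nat).
Implicit Types (A M : 'M[R]_(n + n)) (u v : 'cV[R]_(n + n)).
Implicit Types (U : {vspace 'cV[R]_(n + n)}).

Definition sympJ : 'M[R]_(n + n) := block_mx 0 1%:M (- 1%:M) 0.

Definition dot u v : R := (u^T *m v) 0 0.

Definition posdefmx A : Prop :=
  A^T = A /\ forall x : 'cV[R]_(n + n), x != 0 -> 0 < dot x (A *m x).

Definition symplecticmx M : Prop := M^T *m sympJ *m M = sympJ.

Definition williamson_diag A (d : 'rV[R]_n) : Prop :=
  [/\ forall j, 0 < d 0 j,
      forall j1 j2 : 'I_n, (j1 <= j2)%N -> d 0 j1 <= d 0 j2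
    & exists M, symplecticmx M /\
        M^T *m A *m M = block_mx (diag_mx d) 0 0 (diag_mx d)].

(* By Williamson's theorem exactly one [d] satisfies [williamson_diag A d] when
   [A] is positive definite; the default value 0 is only reached for other [A].
   Indices start at 0: [sympeig A j] is $d_{j+1}(A)$. *)
Definition sympeig A (j : 'I_n) : R :=
  (xget 0 [set d | williamson_diag A d]) 0 j.

Definition sympeigpair A (d : R) u v : Prop :=
  [/\ (exists j, d = sympeig A j), u != 0, v != 0,
      A *m u = d *: (sympJ *m v) & A *m v = (- d) *: (sympJ *m u)].

Definition symplectic_subspace U : Prop :=
  forall u, u \in U -> u != 0 -> exists2 v, v \in U & dot u (sympJ *m v) != 0.

Definition invariant_subspace A U : Prop :=
  forall x, x \in U -> A *m x \in U.

Definition symplectic_basis k U (u v : 'I_k -> 'cV[R]_(n + n)) : Prop :=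
  [/\ basis_of U ([seq u i | i : 'I_k] ++ [seq v i | i : 'I_k]),
      forall i, dot (u i) (sympJ *m v i) = 1
    & forall i j, i != j ->
        [/\ dot (u i) (sympJ *m v j) = 0, dot (u i) (sympJ *m u j) = 0
          & dot (v i) (sympJ *m v j) = 0]].

Definition sympeig_basis k A U (g : 'I_k -> R) : Prop :=
  exists u v : 'I_k -> 'cV[R]_(n + n),
    symplectic_basis U u v /\ forall j, sympeigpair A (g j) (u j) (v j).

(* [g] is the list, in nondecreasing order and with multiplicity, of the
   symplectic eigenvalues of [A] associated with [U]; for [A] positive definite
   and [U] symplectic, [sympJ *m A]-invariant of dimension [2 * k], there is
   exactly one such [g]. *)
Definition associated_sympeigs k A U (g : 'I_k -> R) : Prop :=
  (forall j1 j2 : 'I_k, (j1 <= j2)%N -> g j1 <= g j2) /\ sympeig_basis A U g.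

End SymplecticDefs.

Arguments sympJ {R n}.

(* Main.v *)
Require Import Defs.
From mathcomp Require Import all_boot all_order all_algebra.
From mathcomp Require Import all_classical all_reals.
From mathcomp Require spectral.
From mathcomp Require Import fingroup perm complex zify ring lra.
Import Order.TTheory GRing.Theory Num.Theory.
Local Open Scope ring_scope.
Set Implicit Arguments.
Unset Strict Implicit.
Unset Printing Implicit Defensive.

(** Put f(t) = sum_j d_{i_j}(A + tB) and c = d_1(B) + ... + d_k(B). In a Williamson
    basis of A + tB that also diagonalises the compression of B to each eigenvalue
    cluster, first-order perturbation gives the right slope of f at t as at least
    half the trace of B over the selected pairs, which is at least c for every
    symplectic k-frame. Hence f(1) = f(0) + c forces f to be affine of slope c, the
    trace is minimal at every t, and a frame of minimal trace spans a JB-invariant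
    subspace on which B has symplectic eigenvalues d_1(B), ..., d_k(B); so this span
    U is invariant under JA too. Taking t = s with the fewest coincidences among the
    d_j(A + tB), an eigenvalue of A + tB on U starting at d_{i_j}(A + sB) stays equal
    to d_{i_j}(A + tB) for t slightly larger than s. One subspace and one such
    interval suffice, so r = 1. *)

(** Only lower bounds on growth are proved: minimax yields inequalities in one direction, and the
    hypothesis turns them into equalities, since the increments of f over consecutive subintervals
    of [0, 1] are each at least c times the length and add up to c. The minimax comes from reading
    symplectic eigenvalues as the positive eigenvalues of the Hermitian pencil of A and i J, written
    with pairs of real vectors. A multiple eigenvalue has no slope of its own, so the slopes on a
    cluster must be listed in increasing order to match the indices. The half in front of the trace
    is there because each symplectic eigenvalue belongs to two vectors. On U the eigenvalues of A +
    tB are some d_m(A + tB), with unknown m. For 0 < s <= t the form of A + tB lies between those of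
    A + sB and (t/s)(A + sB), on the whole space and on U alike; so no eigenvalue moves by more than
    the factor t/s, and m must lie in the cluster of i_j at s. This is why s has to be positive. *)

Local Notation dsum d := (block_mx (diag_mx d) 0 0 (diag_mx d)).

(** * Linear algebra and the form J *)

Section ComplexEigenvector.
Variable R : realType.

(* Real and imaginary parts of a common eigenvector over [R[i]]; [x] and [y] may be
   linearly dependent. *)
Lemma real_common_eigenplane (r : nat) (X Y : 'M[R]_r) :
  (0 < r)%N -> X *m Y = Y *m X ->
  exists x y : 'cV[R]_r, ~~ ((x == 0) && (y == 0)) /\
   (exists a b, X *m x = a *: x - b *: y /\ X *m y = a *: y + b *: x) /\
   (exists a b, Y *m x = a *: x - b *: y /\ Y *m y = a *: y + b *: x).
Proof.
move=> r_gt0 XY.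
pose f := @real_complex R.
pose toC (Z : 'M[R]_r) := map_mx f Z^T.
have [v v0 /andP[vX vY]] := @spectral.common_eigenvector2 R[i] r (toC X) (toC Y) r_gt0
  ltac:(by rewrite /toC -!map_mxM -!trmx_mul XY).
pose x : 'cV[R]_r := (map_mx (@complex.Re R) v)^T.
pose y : 'cV[R]_r := (map_mx (@complex.Im R) v)^T.
have step Z : (v *m toC Z <= v)%MS ->
    exists a b, Z *m x = a *: x - b *: y /\ Z *m y = a *: y + b *: x.
  move=> /sub_rVP[c vZ]; exists (complex.Re c), (complex.Im c).
  have E j : (v *m toC Z) 0 j = (c *: v) 0 j by rewrite vZ.
  have ReE j : (Z *m x) j 0 = complex.Re ((v *m toC Z) 0 j).
    rewrite !mxE raddf_sum; apply: eq_bigr => l _; rewrite !mxE.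
    by case: (v 0 l) => p q /=; ring.
  have ImE j : (Z *m y) j 0 = complex.Im ((v *m toC Z) 0 j).
    rewrite !mxE raddf_sum; apply: eq_bigr => l _; rewrite !mxE.
    by case: (v 0 l) => p q /=; ring.
  split; apply/colP => j; rewrite ?ReE ?ImE E !mxE.
    by case: c {vZ E} => a b; case: (v 0 j) => p q /=; ring.
  by case: c {vZ E} => a b; case: (v 0 j) => p q /=; ring.
exists x, y; split; last by split; apply: step.
apply: contra v0 => /andP[/eqP x0 /eqP y0]; apply/eqP/rowP => j.
have := congr1 (fun u : 'cV_r => u j 0) x0.
have := congr1 (fun u : 'cV_r => u j 0) y0.
by rewrite !mxE; case: (v 0 j) => p q /= -> ->.
Qed.

Lemma solve_linear_system (I : finType) (m : nat) (f : I -> 'rV[R]_m) :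
  (#|I| < m)%N -> exists2 x : 'cV[R]_m, x != 0 & forall i, f i *m x = 0.
Proof.
move=> Im; pose E : 'M[R]_(#|I|, m) := \matrix_(i, j) f (enum_val i) 0 j.
have : kermx E^T != 0.
  rewrite -mxrank_eq0 mxrank_ker subn_eq0 -ltnNge.
  exact: leq_ltn_trans (rank_leq_col _) Im.
case/rowV0Pn => v /sub_kermxP vE v0; exists v^T; first by rewrite trmx_eq0.
move=> i; apply/colP => j; rewrite (ord1 j).
have := congr1 (fun u : 'rV_#|I| => u 0 (enum_rank i)) vE.
rewrite !mxE => vE0; rewrite -[RHS]vE0.
by apply: eq_bigr => l _; rewrite !mxE enum_rankK mulrC.
Qed.

(** Supplies one constant for finitely many positive quantities: spectral gaps, smallest
    eigenvalues, radii of validity. The [1] in the minimum serves families without positive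
    members. *)
Lemma pos_uniform (I : finType) (x : I -> R) :
  exists2 e, 0 < e & forall i, 0 < x i -> e <= x i.
Proof.
exists (\big[Num.min/1]_(i | 0 < x i) x i).
  by elim/big_ind: _ => //= a b a0 b0; rewrite lt_min a0 b0.
by move=> i xi; exact: bigmin_le_cond.
Qed.

End ComplexEigenvector.

Section DotJ.
Variable R : realType.
Variable n : nat.
Implicit Types (x y z : 'cV[R]_(n + n)) (A : 'M[R]_(n + n)).
Local Notation J := (@sympJ R n).

Lemma dotC x y : dot x y = dot y x.
Proof. by rewrite /dot -[x^T *m y]trmxK trmx_mul trmxK mxE. Qed.

Lemma dotDl x y z : dot (x + y) z = dot x z + dot y z.
Proof. by rewrite /dot linearD mulmxDl mxE. Qed.

Lemma dotDr x y z : dot z (x + y) = dot z x + dot z y.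
Proof. by rewrite /dot mulmxDr mxE. Qed.

Lemma dotZl a x y : dot (a *: x) y = a * dot x y.
Proof. by rewrite /dot linearZ -scalemxAl mxE. Qed.

Lemma dotZr a x y : dot x (a *: y) = a * dot x y.
Proof. by rewrite dotC dotZl dotC. Qed.

Lemma dotNl x y : dot (- x) y = - dot x y.
Proof. by rewrite -scaleN1r dotZl mulN1r. Qed.

Lemma dotNr x y : dot x (- y) = - dot x y.
Proof. by rewrite dotC dotNl dotC. Qed.

Lemma dot0l x : dot 0 x = 0.
Proof. by rewrite -(scale0r 0) dotZl mul0r. Qed.

Lemma dot0r x : dot x 0 = 0.
Proof. by rewrite dotC dot0l. Qed.

Lemma dotE x y : dot x y = \sum_i x i 0 * y i 0.
Proof. by rewrite /dot mxE; apply: eq_bigr => i _; rewrite mxE. Qed.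

Lemma dot_ge0 x : 0 <= dot x x.
Proof. by rewrite dotE sumr_ge0 // => i _; rewrite -expr2 sqr_ge0. Qed.

Lemma dot_eq0 x : (dot x x == 0) = (x == 0).
Proof.
apply/eqP/eqP => [|->]; last by rewrite dot0l.
rewrite dotE => /eqP; rewrite psumr_eq0; last by move=> i _; rewrite -expr2 sqr_ge0.
by move=> /allP x0; apply/colP => i; have /eqP := x0 i (mem_index_enum i);
  rewrite mxE => /eqP; rewrite mulf_eq0 orbb => /eqP.
Qed.

Lemma sympJT : J^T = - J.
Proof.
by rewrite /sympJ tr_block_mx !trmx0 trmx1 linearN /= trmx1 opp_block_mx
  !oppr0 opprK.
Qed.

Lemma sympJJ : J *m J = - 1%:M.
Proof.
rewrite /sympJ mulmx_block !(mul0mx, mulmx0, mul1mx, mulmx1, mulNmx, mulmxN).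
rewrite !(add0r, addr0) scalar_mx_block opp_block_mx oppr0.
by [].
Qed.

Lemma sympJK p (x : 'M[R]_(n + n, p)) : J *m (J *m x) = - x.
Proof. by rewrite mulmxA sympJJ mulNmx mul1mx. Qed.

End DotJ.

Lemma dotMl (R : realType) (n k : nat) (A : 'M[R]_(n + n, k + k)) x y :
  dot (A *m x) y = dot x (A^T *m y).
Proof. by rewrite /dot trmx_mul mulmxA. Qed.

Lemma dotJ (R : realType) (n : nat) (x y : 'cV[R]_(n + n)) :
  dot (sympJ *m x) y = - dot x (sympJ *m y).
Proof. by rewrite dotMl sympJT mulNmx dotNr. Qed.

Lemma dotJJ (R : realType) (n : nat) (x y : 'cV[R]_(n + n)) :
  dot (sympJ *m x) (sympJ *m y) = dot x y.
Proof. by rewrite dotJ sympJK dotNr opprK. Qed.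

Lemma dotxJx (R : realType) (n : nat) (x : 'cV[R]_(n + n)) :
  dot x (sympJ *m x) = 0.
Proof. by have := dotJ x x; rewrite dotC; lra. Qed.

(** * Simultaneous Williamson form *)

Section SimultaneousWilliamson.
Variables (R : realType) (n : nat) (A C : 'M[R]_(n + n)).
Hypotheses (A_pos : posdefmx A) (C_sym : C^T = C).
Local Notation J := (@sympJ R n).
Hypothesis AC_comm : A *m J *m C = C *m J *m A.

(** The kernel of [E] is stable under [J *m A] and [J *m C], which commute by [AC_comm], so it
    contains the real and imaginary parts [u], [v] of a common eigenvector. Positivity of [A] gives
    [dot u (J *m v) != 0]; symmetry then makes both eigenvalues purely imaginary. *)
Lemma common_sympeigpair (p : nat) (E YA YC : 'M[R]_(p, _)) :
  (p < n + n)%N -> E *m J *m A = YA *m E -> E *m J *m C = YC *m E ->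
  exists (u v : 'cV[R]_(n + n)) (d e : R),
    [/\ E *m u = 0, E *m v = 0, 0 < d & dot u (J *m v) = 1] /\
    [/\ A *m u = d *: (J *m v), A *m v = - d *: (J *m u),
        C *m u = e *: (J *m v) & C *m v = - e *: (J *m u)].
Proof.
move=> p_lt EA EC.
pose r := \rank (kermx E^T).
have r_gt0 : (0 < r)%N.
  by rewrite /r mxrank_ker subn_gt0 (leq_ltn_trans (rank_leq_col _)).
pose Q := (row_base (kermx E^T))^T.
have EQ : E *m Q = 0.
  apply: trmx_inj; rewrite trmx_mul trmx0 trmxK; apply/sub_kermxP.
  by rewrite eq_row_base.
have Q_inj q (x y : 'M_(r, q)) : Q *m x = Q *m y -> x = y.
  move=> /(congr1 trmx); rewrite !trmx_mul trmxK.
  by move=> /(row_free_inj (row_base_free _)) /trmx_inj.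
have stable X Y : E *m J *m X = Y *m E -> exists Z, J *m X *m Q = Q *m Z.
  move=> EX; suff /submxP[Z ZE] : ((J *m X *m Q)^T <= row_base (kermx E^T))%MS.
    by exists Z^T; apply: trmx_inj; rewrite ZE /Q trmx_mul !trmxK.
  rewrite eq_row_base; apply/sub_kermxP; rewrite -trmx_mul !mulmxA EX.
  by rewrite -mulmxA EQ mulmx0 trmx0.
have [X JAQ] := stable _ _ EA.
have [Y JCQ] := stable _ _ EC.
have XY : X *m Y = Y *m X.
  apply: Q_inj; rewrite !mulmxA -JAQ -JCQ -(mulmxA _ Q Y) -(mulmxA _ Q X).
  have := congr1 (fun Z => J *m Z *m Q) AC_comm.
  by rewrite -JAQ -JCQ !mulmxA.
have [x [y [xy0 [[a [b [Xx Xy]]] [a' [b' [Yx Yy]]]]]]] :=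
  real_common_eigenplane r_gt0 XY.
pose u := Q *m x; pose v := Q *m y.
have uv0 : ~~ ((u == 0) && (v == 0)).
  apply: contra xy0 => /andP[/eqP u0 /eqP v0].
  have -> : x = 0 by apply: Q_inj; rewrite mulmx0.
  have -> : y = 0 by apply: Q_inj; rewrite mulmx0.
  by rewrite eqxx.
have Jmul (X' : 'M_(n + n)) w z : J *m X' *m w = z -> X' *m w = - (J *m z).
  by move=> <-; rewrite -mulmxA sympJK opprK.
have split_eq (X' : 'M_(n + n)) a1 b1 w z :
    J *m X' *m w = a1 *: w - b1 *: z -> X' *m w = b1 *: (J *m z) - a1 *: (J *m w).
  by move=> /Jmul ->; rewrite mulmxBr -!scalemxAr opprB.
have stab_eq X' Z a1 b1 w z : J *m X' *m Q = Q *m Z -> Z *m w = a1 *: w - b1 *: z ->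
    X' *m (Q *m w) = b1 *: (J *m (Q *m z)) - a1 *: (J *m (Q *m w)).
  move=> XQ Zw; apply: split_eq.
  by rewrite mulmxA XQ -mulmxA Zw mulmxBr -!scalemxAr.
have Au : A *m u = b *: (J *m v) - a *: (J *m u) by apply: stab_eq JAQ Xx.
have Cu : C *m u = b' *: (J *m v) - a' *: (J *m u) by apply: stab_eq JCQ Yx.
have Av : A *m v = - b *: (J *m u) - a *: (J *m v).
  by apply: stab_eq JAQ _; rewrite Xy scaleNr opprK.
have Cv : C *m v = - b' *: (J *m u) - a' *: (J *m v).
  by apply: stab_eq JCQ _; rewrite Yy scaleNr opprK.
have [A_sym A_gt0] := A_pos.
pose s := dot u (J *m v).
have vu : dot v (J *m u) = - s by rewrite /s dotC dotJ.
(* Symmetry equates [dot v (X' *m u) = a1 * s] with [dot u (X' *m v) = - a1 * s]. *)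
have quad X' a1 b1 : X'^T = X' -> X' *m u = b1 *: (J *m v) - a1 *: (J *m u) ->
    X' *m v = - b1 *: (J *m u) - a1 *: (J *m v) ->
    a1 * s = 0 /\ dot u (X' *m u) + dot v (X' *m v) = 2 * b1 * s.
  move=> Xs Xu Xv; have := dotMl X' u v; rewrite Xs dotC Xu Xv.
  rewrite !(dotDr, dotNr, dotZr) !dotxJx vu -/s => h; split; first by lra.
  by ring.
have [as0 qA] := quad A a b A_sym Au Av.
have [as0' _] := quad C a' b' C_sym Cu Cv.
have q_gt0 : 0 < 2 * b * s.
  rewrite -qA; have q_ge0 w : 0 <= dot w (A *m w).
    by have [->|/A_gt0/ltW//] := eqVneq w 0; rewrite dot0l.
  move: uv0; rewrite negb_and => /orP[] /A_gt0 h.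
    by rewrite ltr_wpDr.
  by rewrite ltr_wpDl.
have bs_gt0 : 0 < b * s by lra.
have s0 : s != 0 by apply/eqP => s0; move: bs_gt0; rewrite s0 mulr0 ltxx.
move/eqP: as0; rewrite mulf_eq0 (negPf s0) orbF => /eqP a0.
move/eqP: as0'; rewrite mulf_eq0 (negPf s0) orbF => /eqP a'0.
rewrite {}a0 !scale0r !subr0 in Au Av; rewrite {}a'0 !scale0r !subr0 in Cu Cv.
have EQ0 w : E *m (Q *m w) = 0 by rewrite mulmxA EQ mul0mx.
have scaled w1 w2 s1 b1 b2 : dot w1 (J *m w2) = s1 -> 0 < s1 -> 0 < b1 ->
    A *m w1 = b1 *: (J *m w2) -> A *m w2 = - b1 *: (J *m w1) ->
    C *m w1 = b2 *: (J *m w2) -> C *m w2 = - b2 *: (J *m w1) ->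
    let c := (Num.sqrt s1)^-1 in
    [/\ 0 < b1, dot (c *: w1) (J *m (c *: w2)) = 1,
        A *m (c *: w1) = b1 *: (J *m (c *: w2)),
        A *m (c *: w2) = - b1 *: (J *m (c *: w1)) &
        C *m (c *: w1) = b2 *: (J *m (c *: w2)) /\
        C *m (c *: w2) = - b2 *: (J *m (c *: w1))].
  move=> s1E s1_gt0 b1_gt0 Aw1 Aw2 Cw1 Cw2 c; rewrite -!scalemxAr.
  rewrite Aw1 Aw2 Cw1 Cw2 !scalerA !(mulrC c); split=> //.
  rewrite dotZl dotZr s1E mulrA -expr2 exprVn sqr_sqrtr ?ltW //.
  by rewrite mulVf // gt_eqF.
have [s_gt0|s_le0] := ltP 0 s.
  have b_gt0 : 0 < b by rewrite -(pmulr_lgt0 _ s_gt0).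
  have [h1 h2 h3 h4 [h5 h6]] := scaled u v s b b' erefl s_gt0 b_gt0 Au Av Cu Cv.
  exists ((Num.sqrt s)^-1 *: u), ((Num.sqrt s)^-1 *: v), b, b'.
  by split; split; rewrite // -scalemxAr EQ0 scaler0.
(* For [s < 0] the conjugate eigenvector, with [- v] for [v], reverses the signs of the pairing and
   of both eigenvalues. *)
have s_lt0 : 0 < - s by rewrite oppr_gt0 lt_neqAle s0.
have b_gt0 : 0 < - b by rewrite -(pmulr_lgt0 _ s_lt0) mulrNN.
have [] := scaled u (- v) (- s) (- b) (- b') _ s_lt0 b_gt0.
- by rewrite mulmxN dotNr.
- by rewrite Au mulmxN scalerN scaleNr opprK.
- by rewrite mulmxN Av !scaleNr !opprK.
- by rewrite Cu mulmxN scalerN scaleNr opprK.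
- by rewrite mulmxN Cv !scaleNr !opprK.
move=> h1 h2 h3 h4 [h5 h6].
exists ((Num.sqrt (- s))^-1 *: u), ((Num.sqrt (- s))^-1 *: - v), (- b), (- b').
by split; split; rewrite // -scalemxAr ?mulmxN EQ0 ?oppr0 scaler0.
Qed.

Definition symplectic_frame m (U V : 'M[R]_(n + n, m)) : Prop :=
  [/\ U^T *m J *m V = 1%:M, U^T *m J *m U = 0 & V^T *m J *m V = 0].

Definition eigenframe (X : 'M[R]_(n + n)) m (U V : 'M[R]_(n + n, m)) d : Prop :=
  X *m U = J *m V *m diag_mx d /\ X *m V = - (J *m U *m diag_mx d).

Definition frame m (U V : 'M[R]_(n + n, m)) (d e : 'rV[R]_m) : Prop :=
  [/\ symplectic_frame U V, forall j, 0 < d 0 j,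
      eigenframe A U V d & eigenframe C U V e].

(** The kernel of [E] below is the [J]-orthogonal complement of the frame: stable under [J *m A] and
    [J *m C] because the span of the frame is, and nonzero because [m < n]. A pair found there
    enlarges the frame. *)
Lemma frame_extend m U V d e : (m < n)%N -> @frame m U V d e ->
  exists U' V' d' e', @frame (m + 1) U' V' d' e'.
Proof.
move=> mn [[UV UU VV] d_gt0 [AU AV] [CU CV]].
pose E := col_mx (U^T *m J) (V^T *m J).
have key X a : X^T = X -> X *m U = J *m V *m diag_mx a ->
    X *m V = - (J *m U *m diag_mx a) ->
    E *m J *m X = block_mx 0 (diag_mx a) (- diag_mx a) 0 *m E.
  move=> Xs XU XV; rewrite /E !mul_col_mx -!mulmxA !(mulmxA J) sympJJ.
  rewrite !mulNmx mul1mx !mulmxN -[X]Xs -!trmx_mul XU XV.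
  rewrite linearN /= !trmx_mul tr_diag_mx sympJT !mul_row_col !mul0mx.
  by rewrite add0r addr0 !(mulmxN, mulNmx) !opprK !mulmxA.
have [A_sym _] := A_pos.
have mm_lt : (m + m < n + n)%N by lia.
have [u [v [d1 [e1 [[Eu Ev d1_gt0 uv] [Au Av Cu Cv]]]]]] :=
  common_sympeigpair mm_lt (key A d A_sym AU AV) (key C e C_sym CU CV).
move: Eu Ev; rewrite /E !mul_col_mx -!col_mx0 => /eq_col_mx[Uu Vu] /eq_col_mx[Uv Vv].
have flip p q (X : 'M_(n + n, p)) (Y : 'M_(n + n, q)) :
    X^T *m J *m Y = 0 -> Y^T *m J *m X = 0.
  move=> XY; apply: trmx_inj; rewrite !trmx_mul trmxK sympJT mulNmx mulmxN mulmxA.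
  by rewrite XY trmx0 oppr0.
have mx11 (x y : 'cV[R]_(n + n)) : x^T *m J *m y = (dot x (J *m y))%:M.
  by rewrite [LHS]mx11_scalar /dot mulmxA.
exists (row_mx U u), (row_mx V v), (row_mx d d1%:M), (row_mx e e1%:M).
have block p (W W' : 'M_(n + n, m)) (w w' : 'M_(n + n, p)) :
    (row_mx W w)^T *m J *m row_mx W' w' =
    block_mx (W^T *m J *m W') (W^T *m J *m w') (w^T *m J *m W') (w^T *m J *m w').
  by rewrite tr_row_mx mul_col_mx mul_col_row.
have act X (W W' : 'M_(n + n, m)) (w w' : 'cV_(n + n)) a b :
    X *m W = J *m W' *m diag_mx a -> X *m w = b *: (J *m w') ->
    X *m row_mx W w = J *m row_mx W' w' *m diag_mx (row_mx a b%:M).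
  move=> XW Xw; rewrite diag_mx_row !mul_mx_row mul_row_block !mulmx0 addr0 add0r.
  have -> : diag_mx b%:M = b%:M :> 'M_1.
    by apply/matrixP => i j; rewrite !mxE (ord1 i) (ord1 j).
  by rewrite XW Xw mul_mx_scalar.
have act' X (W W' : 'M_(n + n, m)) (w w' : 'cV_(n + n)) a b :
    X *m W = - (J *m W' *m diag_mx a) -> X *m w = - b *: (J *m w') ->
    X *m row_mx W w = - (J *m row_mx W' w' *m diag_mx (row_mx a b%:M)).
  move=> XW Xw; rewrite -mulNmx -mulmxN opp_row_mx; apply: act.
    by rewrite mulmxN mulNmx.
  by rewrite mulmxN scalerN -scaleNr.
split; [split| |split|split]; rewrite ?block ?UV ?UU ?VV ?(flip _ _ _ _ Uu) ?(flip _ _ _ _ Vu).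
- by rewrite Uv mx11 uv -scalar_mx_block.
- by rewrite Uu mx11 dotxJx raddf0 block_mx0.
- by rewrite Vv (flip _ _ _ _ Vv) mx11 dotxJx raddf0 block_mx0.
- by move=> j; rewrite mxE; case: splitP => l _; rewrite // mxE (ord1 l) eqxx.
- exact: act.
- exact: act'.
- exact: act.
- exact: act'.
Qed.

Lemma frame_exists m : (m <= n)%N -> exists U V d e, @frame m U V d e.
Proof.
elim: m => [_|m IH mn].
  exists 0, 0, 0, 0; split; [split| |split|split]; try by apply/matrixP => - [] // ? ? [].
  by case.
have [U [V [d [e F]]]] := IH (ltnW mn).
by rewrite -addn1; exact: frame_extend F.
Qed.

(** [AC_comm] says that [J *m A] and [J *m C] commute. For [C = A] this is the existence part of
    Williamson's theorem, up to the ordering of the diagonal. *)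
Lemma simultaneous_williamson : exists M (d e : 'rV[R]_n),
  [/\ symplecticmx M, forall j, 0 < d 0 j,
      M^T *m A *m M = block_mx (diag_mx d) 0 0 (diag_mx d)
    & M^T *m C *m M = block_mx (diag_mx e) 0 0 (diag_mx e)].
Proof.
have [U [V [d [e [[UV UU VV] d_gt0 [AU AV] [CU CV]]]]]] := frame_exists (leqnn n).
have VU : V^T *m J *m U = - 1%:M.
  by apply: trmx_inj; rewrite !trmx_mul trmxK sympJT mulNmx mulmxN mulmxA UV linearN /= trmx1.
have congr X a : X *m U = J *m V *m diag_mx a -> X *m V = - (J *m U *m diag_mx a) ->
    (row_mx U V)^T *m X *m row_mx U V = block_mx (diag_mx a) 0 0 (diag_mx a).
  move=> XU XV; rewrite tr_row_mx mul_col_mx mul_col_row -!(mulmxA _ X) XU XV.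
  rewrite !mulmxN !mulmxA UV UU VV VU !mul0mx mulNmx !mul1mx opprK oppr0.
  by [].
exists (row_mx U V), d, e; split=> //; try exact: congr.
by rewrite /symplecticmx tr_row_mx mul_col_mx mul_col_row UV UU VV VU.
Qed.
End SimultaneousWilliamson.

(** * Minimax comparison *)

Definition sorted_row (R : realType) n (d : 'rV[R]_n) :=
  forall j1 j2 : 'I_n, (j1 <= j2)%N -> d 0 j1 <= d 0 j2.

Section Energy.
Variables (R : realType) (n : nat).
Implicit Types (x a c : 'cV[R]_(n + n)) (d : 'rV[R]_n) (X : 'M[R]_(n + n)).
Local Notation J := (@sympJ R n).

(* A pair [(a, c)] stands for the complex vector [a - i c]: [quad X a c] is the
   Hermitian form of [X] and [2 * dot a (J *m c)] that of [i J]. The vectors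
   [a + J c] and [a - J c] encode its components on the positive and negative parts
   of [i J]. *)
Definition energy (l : 'I_n) x := x (lshift n l) 0 ^+ 2 + x (rshift n l) 0 ^+ 2.

Definition quad X a c := dot a (X *m a) + dot c (X *m c).

Lemma dot_congr k (F : 'M[R]_(n + n, k + k)) X y z :
  dot (F *m y) (X *m (F *m z)) = dot y (F^T *m X *m F *m z).
Proof. by rewrite dotMl !mulmxA. Qed.

Lemma energy_ge0 l x : 0 <= energy l x.
Proof. by rewrite addr_ge0 ?sqr_ge0. Qed.

Lemma dot_split x a : dot x a =
  \sum_l (x (lshift n l) 0 * a (lshift n l) 0 + x (rshift n l) 0 * a (rshift n l) 0).
Proof. by rewrite dotE big_split_ord big_split. Qed.

Lemma dot_energy x : dot x x = \sum_l energy l x.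
Proof. by rewrite dot_split. Qed.

Lemma mul_dsum p d (x : 'M[R]_(n + n, p)) l j :
  (dsum d *m x) (lshift n l) j = d 0 l * x (lshift n l) j /\
  (dsum d *m x) (rshift n l) j = d 0 l * x (rshift n l) j.
Proof.
rewrite -[x]vsubmxK mul_block_col !mul0mx addr0 add0r !col_mxEu !col_mxEd.
by rewrite !mul_diag_mx !mxE.
Qed.

Lemma mul_sympJ x l : (J *m x) (lshift n l) 0 = x (rshift n l) 0 /\
  (J *m x) (rshift n l) 0 = - x (lshift n l) 0.
Proof.
rewrite -[x]vsubmxK mul_block_col !mul0mx addr0 add0r !col_mxEu !col_mxEd.
by rewrite mulNmx !mul1mx !mxE.
Qed.

Lemma eq_col_halves x a : (forall l, x (lshift n l) 0 = a (lshift n l) 0 /\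
  x (rshift n l) 0 = a (rshift n l) 0) -> x = a.
Proof.
by move=> h; apply/colP => i; rewrite -(fintype.splitK i);
  case: (fintype.split i) => l /=; have [] := h l.
Qed.

Lemma dot_dsum d x : dot x (dsum d *m x) = \sum_l d 0 l * energy l x.
Proof.
rewrite dot_split; apply: eq_bigr => l _; have [-> ->] := mul_dsum d x l 0.
by rewrite /energy; ring.
Qed.

Lemma energyJ l x : energy l (J *m x) = energy l x.
Proof. by rewrite /energy; have [-> ->] := mul_sympJ x l; ring. Qed.

(** Both Hermitian forms are diagonal in the components [a + J *m c] and [a - J *m c]: pair [l]
    enters with weight [d 0 l - t] on the positive part of [i J] and [d 0 l + t] on the negative
    part. *)
Lemma quad_dsum_split d t a c :
  quad (dsum d) a c - t * (2 * dot a (J *m c)) =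
  2^-1 * \sum_l ((d 0 l - t) * energy l (a + J *m c) +
                 (d 0 l + t) * energy l (a - J *m c)).
Proof.
rewrite /quad !dot_dsum.
under [\sum_l d 0 l * energy l c]eq_bigr do rewrite -energyJ.
rewrite dot_split -!big_split /= !mulr_sumr -sumrB; apply: eq_bigr => l _.
by rewrite /energy !mxE; field.
Qed.

End Energy.

Lemma quad_congr (R : realType) n k (F : 'M[R]_(n + n, k + k)) X y z :
  quad X (F *m y) (F *m z) = quad (F^T *m X *m F) y z.
Proof. by rewrite /quad !(dot_congr F). Qed.

Section MinMax.
Variables (R : realType) (n k : nat).
Local Notation J := (@sympJ R _).

(* The [2 j] real constraints cut the [2 (j + 1)]-dimensional positive part spanned by
   the first [j + 1] pairs of [F], so some [(F y, - F J y)] satisfies them all. *)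
Lemma minmax_lower (k_le_n : (k <= n)%N) (X P : 'M[R]_(n + n))
    (F : 'M[R]_(n + n, k + k)) (b : 'rV[R]_k) (j : 'I_k) (t : R) :
  F^T *m J *m F = J -> F^T *m X *m F = dsum b -> sorted_row b ->
  (forall a c : 'cV[R]_(n + n),
     (forall l : 'I_n, (l < j)%N -> energy l (P *m a + J *m (P *m c)) = 0) ->
     t * (2 * dot a (J *m c)) <= quad X a c) ->
  t <= b 0 j.
Proof.
move=> FJ FX b_sorted tX.
(* For [a = F y] and [c = - F J y] the constrained vector is [T y]. Each [l < j] contributes two
   rows of [T]; each [l > j] contributes two unit rows, which confine [y] to the first [j + 1]
   pairs. *)
pose T := P *m F - J *m P *m F *m J.
pose I : finType := ({l : 'I_k | l != j} * bool)%type.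
pose f (i : I) : 'rV[R]_(k + k) :=
  let l := val i.1 in
  if (l < j)%N then
    let l' := widen_ord k_le_n l in
    row (if i.2 then lshift n l' else rshift n l') T
  else delta_mx 0 (if i.2 then lshift k l else rshift k l).
have cardI : (#|I| < k + k)%N.
  rewrite card_prod card_bool card_sig cardC1 card_ord.
  by have := ltn_ord j; lia.
have [y y0 fy] := solve_linear_system f cardI.
have y_supp (l : 'I_k) : (j < l)%N -> energy l y = 0.
  move=> jl; have lj : l != j by rewrite neq_ltn jl orbT.
  have := fy (exist _ l lj, true); have := fy (exist _ l lj, false).
  rewrite /f /= ltnNge (ltnW jl) /= -!rowE.
  move=> /colP/(_ 0) e1 /colP/(_ 0) e2; move: e1 e2; rewrite !mxE /energy => -> ->.
  by rewrite expr0n addr0.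
have key := tX (F *m y) (- (F *m (J *m y))) _.
have g2 : dot (F *m y) (J *m - (F *m (J *m y))) = dot y y.
  by rewrite mulmxN dotNr dot_congr FJ sympJK dotNr opprK.
have q2 : quad X (F *m y) (- (F *m (J *m y))) = 2 * \sum_l b 0 l * energy l y.
  rewrite /quad mulmxN dotNl dotNr opprK !(dot_congr F) FX !dot_dsum.
  under [X in _ + X]eq_bigr do rewrite energyJ.
  by ring.
have dot_gt0 : 0 < dot y y by rewrite lt0r dot_eq0 y0 dot_ge0.
have q_le : \sum_l b 0 l * energy l y <= b 0 j * dot y y.
  rewrite dot_energy mulr_sumr ler_sum // => l _.
  have [lj|jl] := leqP l j; first by rewrite ler_wpM2r ?energy_ge0 ?b_sorted.
  by rewrite y_supp // !mulr0.
suff : t * (2 * dot y y) <= b 0 j * (2 * dot y y) by rewrite ler_pM2r // mulr_gt0.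
apply: (le_trans (y := 2 * \sum_l b 0 l * energy l y)); last by lra.
rewrite -q2 -g2; apply: key => l lj.
have lk : (l < k)%N by exact: ltn_trans (ltn_ord j).
pose l' := Ordinal lk.
have l'j : l' != j by rewrite neq_ltn lj.
have lE : widen_ord k_le_n l' = l by apply: val_inj.
have -> : P *m (F *m y) + J *m (P *m - (F *m (J *m y))) = T *m y.
  by rewrite /T mulmxBl !mulmxN !mulmxA.
have := fy (exist _ l' l'j, true); have := fy (exist _ l' l'j, false).
rewrite /f /= lj lE /energy -!row_mul => /colP/(_ 0) e1 /colP/(_ 0) e2.
by move: e1 e2; rewrite !mxE => -> ->; rewrite expr0n addr0.
Qed.

End MinMax.

(** * Williamson's theorem and uniqueness of the symplectic eigenvalues *)

Section Williamson.
Variable R : realType.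
Local Notation J := (@sympJ R _).

Lemma symplectic_unit n (M : 'M[R]_(n + n)) : symplecticmx M -> M \in unitmx.
Proof.
move=> MJ; suff /mulmx1_unit[] : - (J *m (M^T *m J)) *m M = 1%:M by [].
by rewrite mulNmx -mulmxA [_ *m M]MJ sympJJ opprK.
Qed.

(** On vectors whose positive part has no component in the pairs below [j], [quad_dsum_split] bounds
    the form of [A] below by [d_j] times that of [i J]. A square [F] gives monotonicity and
    uniqueness of the symplectic eigenvalues, a rectangular one their interlacing under
    compression. *)
Lemma le_sympeig_diag n k (k_le_n : (k <= n)%N) (A X M : 'M[R]_(n + n))
    (F : 'M[R]_(n + n, k + k)) (d : 'rV[R]_n) (b : 'rV[R]_k) (j : 'I_k) :
  symplecticmx M -> M^T *m A *m M = dsum d -> sorted_row d -> (forall l, 0 < d 0 l) ->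
  F^T *m J *m F = J -> F^T *m X *m F = dsum b -> sorted_row b ->
  (forall x, dot x (A *m x) <= dot x (X *m x)) ->
  d 0 (widen_ord k_le_n j) <= b 0 j.
Proof.
move=> MJ MA d_sorted d_gt0 FJ FX b_sorted AX.
have MU := symplectic_unit MJ.
apply: (minmax_lower k_le_n (P := invmx M) FJ FX b_sorted) => a c ac0.
apply: (@le_trans _ _ (quad A a c)); last by rewrite lerD.
have MK (x : 'cV_(n + n)) : exists y, x = M *m y by exists (invmx M *m x); rewrite mulKVmx.
have [[a' aE] [c' cE]] := (MK a, MK c); move: ac0; rewrite {}aE {}cE !mulKmx // => ac0.
rewrite quad_congr dot_congr MJ MA.
rewrite -subr_ge0 quad_dsum_split mulr_ge0 ?invr_ge0 // sumr_ge0 // => l _.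
rewrite addr_ge0 //; last by rewrite mulr_ge0 ?energy_ge0 // addr_ge0 // ltW.
have [lj|jl] := ltnP l j; first by rewrite ac0 // mulr0.
by rewrite mulr_ge0 ?energy_ge0 // subr_ge0 d_sorted.
Qed.

(** The tie-break by [e] will put the slopes within a cluster of equal eigenvalues in increasing
    order. *)
Lemma sorting_perm n (d e : 'rV[R]_n) : exists p : {perm 'I_n},
  forall l1 l2 : 'I_n, (l1 <= l2)%N -> d 0 (p l1) < d 0 (p l2) \/
    (d 0 (p l1) = d 0 (p l2) /\ e 0 (p l1) <= e 0 (p l2)).
Proof.
pose r (i j : 'I_n) := (d 0 i < d 0 j) || ((d 0 i == d 0 j) && (e 0 i <= e 0 j)).
have r_total : total r.
  by move=> i j; rewrite /r eq_sym; case: ltgtP => //= _; exact: le_total.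
have r_refl : reflexive r by move=> i; rewrite /r eqxx lexx orbT.
have r_trans : transitive r.
  move=> j i k; rewrite /r => /orP[dij|/andP[/eqP dij eij]] /orP[djk|/andP[/eqP djk ejk]].
  - by rewrite (lt_trans dij).
  - by rewrite -djk dij.
  - by rewrite dij djk.
  - by rewrite dij djk eqxx (le_trans eij) ?orbT.
pose s := sort r (enum 'I_n).
have s_size : size s = n by rewrite size_sort size_enum_ord.
have s_uniq : uniq s by rewrite sort_uniq enum_uniq.
pose f (l : 'I_n) := nth l s l.
have f_inj : injective f.
  move=> i j; rewrite /f (set_nth_default j) ?s_size // => /eqP.
  by rewrite nth_uniq ?s_size // => /eqP /val_inj.
exists (perm f_inj) => i j ij; rewrite !permE /f.
have := sorted_leq_nth r_trans r_refl i (sort_sorted r_total (enum 'I_n)) i j.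
rewrite -/s !inE s_size !ltn_ord => /(_ isT isT ij).
rewrite [nth i s j](set_nth_default j) ?s_size // /r => /orP[?|/andP[/eqP ? ?]]; [by left|by right].
Qed.

Lemma williamson_sort n (A C M : 'M[R]_(n + n)) (d e : 'rV[R]_n) :
  symplecticmx M -> M^T *m A *m M = dsum d -> M^T *m C *m M = dsum e ->
  (forall l, 0 < d 0 l) ->
  exists M' d' e', [/\ symplecticmx M', M'^T *m A *m M' = dsum d',
    M'^T *m C *m M' = dsum e', (forall l, 0 < d' 0 l) &
    forall l1 l2 : 'I_n, (l1 <= l2)%N ->
       d' 0 l1 < d' 0 l2 \/ (d' 0 l1 = d' 0 l2 /\ e' 0 l1 <= e' 0 l2)].
Proof.
move=> MJ MA MC d_gt0; have [p p_sorted] := sorting_perm d e.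
pose Q : 'M[R]_n := perm_mx p.
have QK : Q *m Q^T = 1%:M by rewrite tr_perm_mx -perm_mxM mulgV perm_mx1.
have Qd c : Q *m diag_mx c *m Q^T = diag_mx (col_perm p c).
  rewrite tr_perm_mx -row_permE -col_permE; apply/matrixP => i j.
  by rewrite !mxE (inj_eq perm_inj).
pose S := block_mx Q^T 0 0 Q^T.
have ST : S^T = block_mx Q 0 0 Q by rewrite tr_block_mx !trmxK !trmx0.
have Sd c : S^T *m dsum c *m S = dsum (col_perm p c).
  by rewrite ST !mulmx_block !(mul0mx, mulmx0, addr0, add0r) Qd.
have SJ : S^T *m J *m S = J.
  rewrite ST !mulmx_block !(mul0mx, mulmx0, addr0, add0r) mulmx1 mulmxN mulNmx.
  by rewrite mulmx1 QK.
have congr X Y Z : M^T *m X *m M = Y -> S^T *m Y *m S = Z ->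
    (M *m S)^T *m X *m (M *m S) = Z.
  by move=> <- <-; rewrite trmx_mul !mulmxA.
exists (M *m S), (col_perm p d), (col_perm p e); split.
- exact: congr MJ SJ.
- exact: congr MA (Sd _).
- exact: congr MC (Sd _).
- by move=> l; rewrite mxE.
- by move=> l1 l2 /p_sorted; rewrite !mxE.
Qed.

Lemma williamson_exists n (A : 'M[R]_(n + n)) : posdefmx A -> exists d, williamson_diag A d.
Proof.
move=> A_pos; have [M [d [e [MJ d_gt0 MA _]]]] :=
  simultaneous_williamson A_pos A_pos.1 erefl.
have [M' [d' [e' [MJ' MA' _ d'_gt0 d'_sorted]]]] := williamson_sort MJ MA MA d_gt0.
exists d'; split=> //; last by exists M'.
by move=> j1 j2 /d'_sorted [/ltW|[->]].
Qed.

Lemma williamson_uniq n (A : 'M[R]_(n + n)) d d' :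
  williamson_diag A d -> williamson_diag A d' -> d = d'.
Proof.
move=> [d_gt0 d_sorted [M [MJ MA]]] [d'_gt0 d'_sorted [M' [MJ' MA']]].
apply/rowP => j; have wj : widen_ord (leqnn n) j = j by apply: val_inj.
apply/le_anti/andP; split.
  have := le_sympeig_diag (leqnn n) j MJ MA d_sorted d_gt0 MJ' MA' d'_sorted.
  by rewrite wj; apply.
have := le_sympeig_diag (leqnn n) j MJ' MA' d'_sorted d'_gt0 MJ MA d_sorted.
by rewrite wj; apply.
Qed.

Lemma sympeigE n (A : 'M[R]_(n + n)) d j : williamson_diag A d -> sympeig A j = d 0 j.
Proof.
move=> Ad; rewrite /sympeig; case: xgetP => [d' _ /= Ad'|/(_ d)//].
by rewrite (williamson_uniq Ad Ad').
Qed.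

Lemma sympeigP n (A : 'M[R]_(n + n)) : posdefmx A ->
  williamson_diag A (\row_j sympeig A j).
Proof.
move=> /williamson_exists[d Ad]; suff -> : \row_j sympeig A j = d by [].
by apply/rowP => j; rewrite mxE; exact: sympeigE.
Qed.

End Williamson.

(** * Monotonicity and bases adapted to a perturbation *)

Section Monotonicity.
Variables (R : realType) (n : nat).
Implicit Types A B : 'M[R]_(n + n).
Local Notation J := (@sympJ R _).

Lemma posdefmx_ge0 A x : posdefmx A -> 0 <= dot x (A *m x).
Proof.
by move=> [_ A_gt0]; have [->|/A_gt0/ltW//] := eqVneq x 0; rewrite dot0l.
Qed.

Lemma quad_addscale A B t x :
  dot x ((A + t *: B) *m x) = dot x (A *m x) + t * dot x (B *m x).
Proof. by rewrite mulmxDl -scalemxAl dotDr dotZr. Qed.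

Lemma posdefmx_addscale A B t : posdefmx A -> posdefmx B -> 0 <= t -> posdefmx (A + t *: B).
Proof.
move=> A_pos B_pos t_ge0; split=> [|x x0].
  by rewrite linearD linearZ /= A_pos.1 B_pos.1.
by rewrite quad_addscale ltr_wpDr ?mulr_ge0 ?posdefmx_ge0 // A_pos.2.
Qed.

Lemma posdefmx_scale A t : posdefmx A -> 0 < t -> posdefmx (t *: A).
Proof.
move=> A_pos t_gt0; split=> [|x x0]; first by rewrite linearZ /= A_pos.1.
by rewrite -scalemxAl dotZr mulr_gt0 // A_pos.2.
Qed.

Lemma sympeig_gt0 A j : posdefmx A -> 0 < sympeig A j.
Proof. by move=> /sympeigP[/(_ j)]; rewrite mxE. Qed.

Lemma sympeig_sorted A (j1 j2 : 'I_n) :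
  posdefmx A -> (j1 <= j2)%N -> sympeig A j1 <= sympeig A j2.
Proof. by move=> /sympeigP[_ s _] /s; rewrite !mxE. Qed.

Lemma le_sympeig A B j : posdefmx A -> posdefmx B ->
  (forall x, dot x (A *m x) <= dot x (B *m x)) -> sympeig A j <= sympeig B j.
Proof.
move=> /sympeigP[d_gt0 d_sorted [M [MJ MA]]] /sympeigP[_ b_sorted [M' [MJ' MB]]] AB.
have := le_sympeig_diag (leqnn n) j MJ MA d_sorted d_gt0 MJ' MB b_sorted AB.
by rewrite !mxE; have -> : widen_ord (leqnn n) j = j by apply: val_inj.
Qed.

Lemma sympeig_scale A t j : posdefmx A -> 0 < t -> sympeig (t *: A) j = t * sympeig A j.
Proof.
move=> A_pos t_gt0; have [d_gt0 d_sorted [M [MJ MA]]] := sympeigP A_pos.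
rewrite (sympeigE (d := t *: \row_j sympeig A j)) ?mxE ?mxE //; split.
- by move=> l; rewrite mxE mulr_gt0.
- by move=> j1 j2 /d_sorted; rewrite !mxE ler_pM2l.
exists M; split=> //; rewrite -scalemxAr -scalemxAl MA scale_block_mx !scaler0.
by rewrite -linearZ.
Qed.

(** Since [t / s >= 1], the form of [A + t *: B] lies between that of [A + s *: B] and [t / s] times
    it. *)
Lemma sympeig_ray A B s t j : posdefmx A -> posdefmx B -> 0 < s -> s <= t ->
  sympeig (A + s *: B) j <= sympeig (A + t *: B) j <= t / s * sympeig (A + s *: B) j.
Proof.
move=> A_pos B_pos s_gt0 st; have t_gt0 := lt_le_trans s_gt0 st.
have As := posdefmx_addscale A_pos B_pos (ltW s_gt0).
have At := posdefmx_addscale A_pos B_pos (ltW t_gt0).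
rewrite le_sympeig //= => [|x]; last first.
  by rewrite !quad_addscale lerD2l ler_wpM2r ?posdefmx_ge0.
rewrite -sympeig_scale ?divr_gt0 //; apply: le_sympeig => // [|x].
  by apply: posdefmx_scale; rewrite ?divr_gt0.
rewrite -scalemxAl dotZr !quad_addscale mulrDr mulrA divfK ?gt_eqF // lerD2r.
by rewrite ler_peMl ?posdefmx_ge0 // ler_pdivlMr ?mul1r.
Qed.

End Monotonicity.

Lemma posdefmx_dsum (R : realType) n (d : 'rV[R]_n) : (forall l, 0 < d 0 l) -> posdefmx (dsum d).
Proof.
move=> d_gt0; split=> [|x x0]; first by rewrite tr_block_mx !trmx0 !tr_diag_mx.
have : 0 < dot x x by rewrite lt0r dot_eq0 x0 dot_ge0.
rewrite dot_energy dot_dsum; have [e e_gt0 eD] := pos_uniform (fun l => d 0 l).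
move=> x_gt0; apply: lt_le_trans (mulr_gt0 e_gt0 x_gt0) _.
by rewrite mulr_sumr ler_sum // => l _; rewrite ler_wpM2r ?energy_ge0 ?eD.
Qed.

Section Adapted.
Variables (R : realType) (n : nat).
Implicit Types (d : 'rV[R]_n) (X : 'M[R]_n) (y : 'cV[R]_(n + n)) (t : R).
Local Notation J := (@sympJ R _).

(* Projects [X] onto the matrices commuting with [diag_mx d]. *)
Definition mask (d : 'rV[R]_n) (X : 'M[R]_n) :=
  \matrix_(i, j) (if d 0 i == d 0 j then X i j else 0).

Lemma mask_comm d X : diag_mx d *m mask d X = mask d X *m diag_mx d.
Proof.
rewrite mul_diag_mx mul_mx_diag; apply/matrixP => i j; rewrite !mxE.
by case: eqP => [->|_]; [rewrite mulrC | rewrite mul0r mulr0].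
Qed.

Lemma mask_trmx d X : (mask d X)^T = mask d X^T.
Proof. by apply/matrixP => i j; rewrite !mxE eq_sym. Qed.

Lemma maskN d X : mask d (- X) = - mask d X.
Proof. by apply/matrixP => i j; rewrite !mxE; case: eqP; rewrite ?oppr0. Qed.

Lemma mask_form d X t (p q : 'cV[R]_n) :
  (forall l, d 0 l != t -> p l 0 = 0) -> (forall l, d 0 l != t -> q l 0 = 0) ->
  p^T *m (mask d X *m q) = p^T *m (X *m q).
Proof.
move=> p0 q0; apply/matrixP => i j; rewrite (ord1 i) (ord1 j) !mxE.
apply: eq_bigr => l _; rewrite !mxE.
have [lt|/p0 ->] := eqVneq (d 0 l) t; last by rewrite !mul0r.
congr (_ * _); apply: eq_bigr => m _; rewrite !mxE lt eq_sym.
by case: eqVneq => // /q0 ->; rewrite !mulr0.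
Qed.

(** A symplectic congruence from [dsum d] to [dsum d'] carries the eigenvectors for [t] to
    eigenvectors for [t]. On those, positivity makes [M1] commute with [J], although it need not do
    so elsewhere. *)
Lemma eigen_clusters d (M1 : 'M[R]_(n + n)) (d' : 'rV[R]_n) t y :
  (forall l, 0 < d 0 l) -> 0 < t ->
  symplecticmx M1 -> M1^T *m dsum d *m M1 = dsum d' ->
  (forall l, d' 0 l != t -> energy l y = 0) ->
  let x := M1 *m y in
  M1 *m (J *m y) = J *m x /\ (forall l, d 0 l != t -> energy l x = 0).
Proof.
move=> d_gt0 t_gt0 MJ Md y0 x.
have dy z : (forall l, d' 0 l != t -> energy l z = 0) -> dsum d' *m z = t *: z.
  move=> z0; apply: eq_col_halves => l; rewrite ![(t *: z) _ _]mxE.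
  have [-> ->] := mul_dsum d' z l 0; have [->//|/z0 /eqP] := eqVneq (d' 0 l) t.
  rewrite paddr_eq0 ?sqr_ge0 // !sqrf_eq0 => /andP[/eqP -> /eqP ->].
  by rewrite !mulr0.
pose z := M1 *m (J *m y).
have Minj w : M1^T *m w = 0 -> w = 0.
  move=> /(congr1 (mulmx (invmx M1^T))); rewrite mulmx0 mulKmx //.
  by rewrite unitmx_tr symplectic_unit.
have dx : dsum d *m x = - t *: (J *m z).
  apply/eqP; rewrite -subr_eq0; apply/eqP/Minj; rewrite mulmxBr !mulmxA Md dy //.
  by rewrite -scalemxAr !mulmxA MJ -mulmxA sympJK scalerN scaleNr opprK subrr.
have dz : dsum d *m z = t *: (J *m x).
  apply/eqP; rewrite -subr_eq0; apply/eqP/Minj; rewrite mulmxBr !mulmxA Md -mulmxA.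
  rewrite dy => [|l /y0]; last by rewrite energyJ.
  by rewrite -scalemxAr !mulmxA MJ subrr.
have key l : [/\ z (lshift n l) 0 = (J *m x) (lshift n l) 0,
   z (rshift n l) 0 = (J *m x) (rshift n l) 0 & (d 0 l != t -> energy l x = 0)].
  have [dx1 dx2] := mul_dsum d x l 0; have [dz1 dz2] := mul_dsum d z l 0.
  move: dx1 dx2 dz1 dz2; rewrite dx dz ![(- t *: (J *m z)) _ _]mxE ![(t *: (J *m x)) _ _]mxE.
  have [-> ->] := mul_sympJ x l; have [-> ->] := mul_sympJ z l.
  have := d_gt0 l; move: (d 0 l) => e e_gt0 h1 h2 h3 h4.
  (* The factor [e + t] forces [z = J *m x]; what remains is [(e - t) * x = 0] in both
     coordinates. *)
  have et0 : e + t != 0 by rewrite gt_eqF // addr_gt0.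
  have z1 : z (lshift n l) 0 = x (rshift n l) 0 by apply: (mulfI et0); lra.
  have z2 : z (rshift n l) 0 = - x (lshift n l) 0 by apply: (mulfI et0); lra.
  split=> // et; rewrite /energy.
  have et1 : e - t != 0 by rewrite subr_eq0.
  rewrite (_ : x (lshift n l) 0 = 0); last by apply: (mulfI et1); rewrite z2 in h1; lra.
  rewrite (_ : x (rshift n l) 0 = 0); last by apply: (mulfI et1); rewrite z1 in h2; lra.
  by rewrite expr0n addr0.
split=> [|l]; last by have [] := key l.
by apply: eq_col_halves => l; have [] := key l.
Qed.

(* Averaging [B] over [J] and masking it by the eigenvalue clusters of [A] gives a form
   [Bm] commuting with [A], so both diagonalise simultaneously; [Bm] and [B] agree on
   each cluster. [mu] consists of the first-order derivatives of the eigenvalues. *)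
Lemma adapted_williamson (A B : 'M[R]_(n + n)) : posdefmx A -> B^T = B ->
  exists (M : 'M[R]_(n + n)) (mu : 'rV[R]_n),
   [/\ symplecticmx M, M^T *m A *m M = dsum (\row_j sympeig A j),
     forall l1 l2 : 'I_n, (l1 <= l2)%N -> sympeig A l1 = sympeig A l2 ->
       mu 0 l1 <= mu 0 l2 &
     forall t y, 0 < t -> (forall l, sympeig A l != t -> energy l y = 0) ->
       quad B (M *m y) (M *m (J *m y)) = 2 * \sum_l mu 0 l * energy l y].
Proof.
move=> A_pos B_sym; have [D_gt0 D_sorted [M0 [M0J M0A]]] := sympeigP A_pos.
set D := \row_j _ in D_gt0 D_sorted M0A.
pose B0 := M0^T *m B *m M0.
have B0_sym : B0^T = B0 by rewrite /B0 !trmx_mul trmxK B_sym mulmxA.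
pose P := ulsubmx B0; pose Q := ursubmx B0; pose S := drsubmx B0.
have B0E : B0 = block_mx P Q Q^T S.
  by rewrite /Q trmx_ursub B0_sym submxK.
have PT : P^T = P by rewrite /P trmx_ulsub B0_sym.
have ST : S^T = S by rewrite /S trmx_drsub B0_sym.
(* [H] below is [B0 + J^T *m B0 *m J] in blocks, so its form at [x] is [quad B0 x (J *m x)]. *)
pose P' := P + S; pose Q' := Q - Q^T.
pose H := block_mx P' Q' (- Q') P'.
pose Bm := block_mx (mask D P') (mask D Q') (- mask D Q') (mask D P').
have HE x : quad B0 x (J *m x) = dot x (H *m x).
  rewrite /quad dot_congr -dotDr -mulmxDl; congr (dot _ (_ *m _)).
  rewrite B0E sympJT /H /P' /Q' opp_block_mx !mulmx_block add_block_mx.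
  rewrite !(mul0mx, mulmx0, mul1mx, mulmx1, mulNmx, mulmxN, oppr0, add0r, addr0, opprK).
  by rewrite opprB (addrC S).
have BmJ : J^T *m Bm *m J = Bm.
  rewrite sympJT /Bm opp_block_mx !mulmx_block.
  by rewrite !(mul0mx, mulmx0, mul1mx, mulmx1, mulNmx, mulmxN, oppr0, add0r, addr0, opprK).
have Bm_sym : Bm^T = Bm.
  have P'T : P'^T = P' by rewrite linearD /= PT ST.
  have Q'T : Q'^T = - Q' by rewrite linearB /= trmxK opprB.
  by rewrite /Bm tr_block_mx [(- _)^T]linearN /= !mask_trmx P'T Q'T maskN opprK.
have Bm_comm : dsum D *m J *m Bm = Bm *m J *m dsum D.
  rewrite /Bm !mulmx_block.
  rewrite !(mul0mx, mulmx0, mul1mx, mulmx1, mulNmx, mulmxN, oppr0, add0r, addr0, opprK).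
  by rewrite !mask_comm.
have D_pos : posdefmx (dsum D) by exact: posdefmx_dsum.
have [M1' [d1 [e1 [M1J' d1_gt0 M1D' M1B']]]] :=
  simultaneous_williamson D_pos Bm_sym Bm_comm.
have [M1 [d [e [M1J M1D M1B d_gt0 de_sorted]]]] := williamson_sort M1J' M1D' M1B' d1_gt0.
have MJ : symplecticmx (M0 *m M1).
  by have := M1J; rewrite /symplecticmx -{1}M0J trmx_mul !mulmxA.
have MA : (M0 *m M1)^T *m A *m (M0 *m M1) = dsum d.
  by rewrite -M1D -M0A trmx_mul !mulmxA.
have dE l : sympeig A l = d 0 l.
  apply: sympeigE; split=> //; last by exists (M0 *m M1).
  by move=> j1 j2 /de_sorted [/ltW|[->]].
(* [Bm] adds up two copies of the form of [B], hence the half. *)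
exists (M0 *m M1), (2^-1 *: e); split=> //.
- by rewrite MA; congr (dsum _); apply/rowP => l; rewrite mxE dE.
- move=> l1 l2 /de_sorted; rewrite !dE => -[h1 h2|[_ e12] _].
    by rewrite h2 ltxx in h1.
  by rewrite !mxE ler_pM2l ?invr_gt0.
move=> t y t_gt0 y0.
have [JM x0] := eigen_clusters D_gt0 t_gt0 M1J M1D
  (fun l h => y0 l (eq_ind_r (fun c => c != t) h (dE l))).
rewrite -!mulmxA JM (quad_congr M0) HE.
set x := M1 *m y in JM x0 *.
have -> : dot x (H *m x) = dot x (Bm *m x).
  have xu0 l : D 0 l != t -> usubmx x l 0 = 0 /\ dsubmx x l 0 = 0.
    move=> /x0 /eqP; rewrite paddr_eq0 ?sqr_ge0 // !sqrf_eq0 !mxE.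
    by move=> /andP[/eqP -> /eqP ->].
  have xu l h := (xu0 l h).1; have xd l h := (xu0 l h).2.
  rewrite /dot -[x]vsubmxK tr_col_mx !mul_block_col !mul_row_col !mulmxDr.
  by rewrite -maskN !(mask_form _ xu xu, mask_form _ xu xd, mask_form _ xd xu, mask_form _ xd xd).
have -> : dot x (Bm *m x) = 2^-1 * quad Bm x (J *m x).
  by rewrite /quad dot_congr BmJ; field.
rewrite -JM (quad_congr M1) M1B /quad !dot_dsum.
under [X in _ * (_ + X)]eq_bigr do rewrite energyJ.
under [in RHS]eq_bigr do rewrite mxE -mulrA.
by rewrite -mulr_sumr; field.
Qed.
End Adapted.

(** * First-order perturbation *)

Section Perturbation.
Variables (R : realType) (n : nat).
Local Notation J := (@sympJ R _).
Implicit Types (A B X : 'M[R]_(n + n)) (x y : 'cV[R]_(n + n)).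

Lemma form_upper_bound B : exists2 K, 0 <= K & forall x, dot x (B *m x) <= K * dot x x.
Proof.
exists (\sum_i \sum_j `|B i j|) => [|x].
  by apply: sumr_ge0 => i _; apply: sumr_ge0 => j _.
have xi i : x i 0 ^+ 2 <= dot x x.
  rewrite dotE (bigD1 i) //= -expr2 lerDl sumr_ge0 // => l _.
  by rewrite -expr2 sqr_ge0.
rewrite dotE mulr_suml ler_sum // => i _.
rewrite mxE mulr_sumr mulr_suml ler_sum // => j _.
apply: le_trans (ler_norm _) _; rewrite mulrCA normrM ler_wpM2l //.
rewrite ler_norml; have := xi i; have := xi j.
have := sqr_ge0 (x i 0 - x j 0); have := sqr_ge0 (x i 0 + x j 0).
by rewrite sqrrD sqrrB => *; apply/andP; split; lra.
Qed.

(** The weighted Cauchy-Schwarz bound on the cross term, from nonnegativity of [X] at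
    [e *: x + y]. *)
Lemma form_split_lower X x y e : X^T = X -> (forall z, 0 <= dot z (X *m z)) -> 0 < e ->
  (1 - e) * dot x (X *m x) - e^-1 * dot y (X *m y) <= dot (x + y) (X *m (x + y)).
Proof.
move=> X_sym X_ge0 e_gt0.
have sym : dot y (X *m x) = dot x (X *m y) by rewrite dotC dotMl X_sym.
have := X_ge0 (e *: x + y); rewrite !mulmxDr -!scalemxAr !(dotDl, dotDr, dotZl, dotZr) sym.
have := X_ge0 y; move: (dot x (X *m x)) (dot x (X *m y)) (dot y (X *m y)) => p q r r0.
rewrite -(pmulr_rge0 _ (_ : 0 < e^-1)) ?invr_gt0 //.
have -> : e^-1 * (e * (e * p) + e * q + (e * q + r)) = e * p + q + q + e^-1 * r.
  by field; rewrite gt_eqF.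
by move=> h; lra.
Qed.

Lemma energy_dsum (d : 'rV[R]_n) x l : energy l (dsum d *m x) = d 0 l ^+ 2 * energy l x.
Proof. by rewrite /energy; have [-> ->] := mul_dsum d x l 0; ring. Qed.

(** By [minmax_lower] the form of [A + h *: B] need only dominate [t] times that of [i J] where the
    positive part [p] vanishes below [j]. On the cluster of [sympeig A j] the form of [B] gives
    slope at least [mu 0 j], as the slopes increase there. The rest of [p] and the negative part [q]
    meet a spectral gap, which absorbs all errors of order [h]. *)
Lemma sympeig_perturb A B M (mu : 'rV[R]_n) (j : 'I_n) (e : R) :
  posdefmx A -> posdefmx B -> symplecticmx M ->
  M^T *m A *m M = dsum (\row_j sympeig A j) ->
  (forall l1 l2 : 'I_n, (l1 <= l2)%N -> sympeig A l1 = sympeig A l2 ->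
       mu 0 l1 <= mu 0 l2) ->
  (forall t y, 0 < t -> (forall l, sympeig A l != t -> energy l y = 0) ->
       quad B (M *m y) (M *m (J *m y)) = 2 * \sum_l mu 0 l * energy l y) ->
  0 < e -> exists2 h0, 0 < h0 & forall h, 0 < h < h0 ->
    sympeig A j + h * (mu 0 j - e) <= sympeig (A + h *: B) j.
Proof.
move=> A_pos B_pos MJ MA mu_sorted MB e_gt0.
pose d l := sympeig A l; pose m := mu 0 j.
pose X := M^T *m B *m M.
have X_sym : X^T = X by rewrite /X !trmx_mul trmxK B_pos.1 mulmxA.
have X_ge0 z : 0 <= dot z (X *m z) by rewrite -dot_congr posdefmx_ge0.
have [K K_ge0 XK] := form_upper_bound X.
have [g g_gt0 gd] := pos_uniform (fun l => d l - d j).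
(* The weight for splitting off cross terms: it costs the cluster a slope of [f * m], at most
   [e]. *)
pose f := e / (e + `|m|).
have em_gt0 : 0 < e + `|m| by rewrite ltr_wpDr.
have f_gt0 : 0 < f by rewrite divr_gt0.
have fm : f * m <= e.
  rewrite /f mulrAC ler_pdivrMr // ler_pM2l //.
  by have := ler_norm m; lra.
have f_le1 : f <= 1 by rewrite ler_pdivrMr // mul1r lerDl.
(* [g] is the gap above [d j], for the part of [p] off the cluster; [d j] serves for [q], whose
   weights are at least [d l + d j] up to order [h]. *)
pose k := Num.min g (d j).
have k_gt0 : 0 < k by rewrite lt_min g_gt0 sympeig_gt0.
(* The error per unit of [h] off the cluster: the shift of [t], and the price of the cross terms. *)
pose c := `|m - e| + f^-1 * K.
have c_ge0 : 0 <= c by rewrite addr_ge0 // mulr_ge0 // invr_ge0 ltW.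
exists (k / (c + 1)) => [|h /andP[h_gt0]]; first by rewrite divr_gt0 // ltr_wpDl.
rewrite ltr_pdivlMr ?ltr_wpDl // => hc.
have C_pos := posdefmx_addscale A_pos B_pos (ltW h_gt0).
have [_ b_sorted [M' [MJ' MC]]] := sympeigP C_pos.
have <- : (\row_l sympeig (A + h *: B) l) 0 j = sympeig (A + h *: B) j by rewrite mxE.
apply: (minmax_lower (leqnn n) (P := invmx M) MJ' MC b_sorted).
have MU := symplectic_unit MJ.
move=> a0 c0.
have MK (x : 'cV_(n + n)) : exists y, x = M *m y by exists (invmx M *m x); rewrite mulKVmx.
have [[a aE] [b bE]] := (MK a0, MK c0); rewrite {}aE {}bE !mulKmx // => ab0.
rewrite quad_congr dot_congr MJ mulmxDr mulmxDl -scalemxAr -scalemxAl MA -/X.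
have quadD Y Z : quad (Y + h *: Z) a b = quad Y a b + h * quad Z a b.
  by rewrite /quad !quad_addscale mulrDr addrACA.
rewrite {}quadD -subr_ge0 addrAC quad_dsum_split.
set t := sympeig A j + _; set p := a + J *m b in ab0 *; set q := a - J *m b.
pose chi : 'rV[R]_n := \row_l (d l == d j)%:R.
pose chi' : 'rV[R]_n := \row_l (d l != d j)%:R.
pose pc := dsum chi *m p; pose pr := dsum chi' *m p.
have pE : p = pc + pr.
  apply: eq_col_halves => l; rewrite ![(pc + pr) _ _]mxE /pc /pr.
  have [-> ->] := mul_dsum chi p l 0; have [-> ->] := mul_dsum chi' p l 0.
  by rewrite !mxE; case: eqP => _ /=; split; ring.
have pcE l : energy l pc = (d l == d j)%:R * energy l p.
  by rewrite /pc energy_dsum mxE; case: eqP => _ /=; ring.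
have prE l : energy l pr = (d l != d j)%:R * energy l p.
  by rewrite /pr energy_dsum mxE; case: eqP => _ /=; ring.
(* As [a = (p + q) / 2] and [J *m b = (p - q) / 2], the pair [(a, b)] is the cluster pair
   [(y, - J *m y)], to which [MB] applies, plus a remainder made of [pr] and [q]. *)
pose y := 2^-1 *: pc; pose a2 := 2^-1 *: (pr + q); pose w := 2^-1 *: (pr - q).
have aE : a = y + a2.
  rewrite /y /a2 -scalerDr addrA -pE /p /q addrACA subrr addr0 -mulr2n -scaler_nat scalerA.
  by rewrite mulVf ?scale1r // pnatr_eq0.
have JbE : J *m b = y + w.
  rewrite /y /w -scalerDr addrA -pE /p /q opprB [a + _]addrC -addrA [a + _]addrC subrK.
  rewrite -mulr2n -scaler_nat scalerA.
  by rewrite mulVf ?scale1r // pnatr_eq0.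
have bE : b = - (J *m y + J *m w) by rewrite -mulmxDr -JbE sympJK opprK.
have XbE : quad X a b = dot (y + a2) (X *m (y + a2)) +
    dot (J *m y + J *m w) (X *m (J *m y + J *m w)).
  by rewrite /quad {1 2}aE bE mulmxN dotNl dotNr opprK.
have X1 := form_split_lower y a2 X_sym X_ge0 f_gt0.
have X2 := form_split_lower (J *m y) (J *m w) X_sym X_ge0 f_gt0.
have main : 2^-1 * m * dot pc pc <= quad X y (J *m y).
  rewrite -quad_congr (MB (d j)) ?sympeig_gt0 //; last first.
    move=> l dl; rewrite /y /energy ![(2^-1 *: pc) _ _]mxE !exprMn -mulrDr -/(energy l pc).
    by rewrite pcE (negPf dl) mul0r mulr0.
  rewrite dot_energy !mulr_sumr ler_sum // => l _.
  have -> : energy l y = 2^-1 ^+ 2 * energy l pc.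
    by rewrite /y /energy ![(2^-1 *: pc) _ _]mxE; ring.
  have [lj|jl] := ltnP l j.
    by rewrite pcE ab0 // !mulr0.
  rewrite pcE; have [dlj|_] := eqVneq (d l) (d j); last by rewrite !mul0r !mulr0.
  have := mu_sorted _ _ jl (esym dlj); have := energy_ge0 l p.
  rewrite -/m /= => E_ge0 /(ler_wpM2r E_ge0) h1.
  by lra.
have rest : quad X a2 (J *m w) <= 2^-1 * K * (dot pr pr + dot q q).
  apply: le_trans (lerD (XK _) (XK _)) _; rewrite dotJJ.
  have par (u v : 'cV[R]_(n + n)) : dot (2^-1 *: (u + v)) (2^-1 *: (u + v)) +
      dot (2^-1 *: (u - v)) (2^-1 *: (u - v)) = 2^-1 * (dot u u + dot v v).
    by rewrite !(dotZl, dotZr, dotDl, dotDr, dotNl, dotNr) (dotC v u); field.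
  by rewrite -mulrDr par mulrCA mulrA.
have diag : k * (dot pr pr + dot q q) - h * (m - e) * (dot pc pc + dot pr pr - dot q q) <=
   \sum_l (((\row_l0 sympeig A l0) 0 l - t) * energy l p +
           ((\row_l0 sympeig A l0) 0 l + t) * energy l q).
  rewrite !dot_energy -!big_split /= -sumrB !mulr_sumr -sumrB ler_sum //= => l _.
  rewrite mxE pcE prE /t -/(d l) -/(d j) -/m.
  have Ep := energy_ge0 l p; have Eq := energy_ge0 l q.
  have dl : 0 < d l by apply: sympeig_gt0.
  have h1 : k * energy l q <= (d l + d j) * energy l q.
    by rewrite ler_wpM2r // /k ge_min lerDr (ltW dl) orbT.
  have h2 : k * ((d l != d j)%:R * energy l p) <= (d l - d j) * energy l p.
    have [->|dlj] := eqVneq (d l) (d j); first by rewrite subrr !mul0r mulr0.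
    have [lj|jl] := ltnP l j; first by rewrite ab0 // !mulr0.
    rewrite mul1r ler_wpM2r // /k ge_min gd // subr_gt0 lt_neqAle eq_sym dlj.
    exact: sympeig_sorted.
  have h3 : (d l == d j)%:R * energy l p + (d l != d j)%:R * energy l p = energy l p.
    by case: eqP => _ /=; ring.
  by rewrite h3; lra.
have [Ec Er Eq] : [/\ 0 <= dot pc pc, 0 <= dot pr pr & 0 <= dot q q] by rewrite !dot_ge0.
have f1 : 0 <= 1 - f by rewrite subr_ge0.
have fV : 0 <= f^-1 by rewrite invr_ge0 ltW.
have XabE : (1 - f) * (2^-1 * m * dot pc pc) - f^-1 * (2^-1 * K * (dot pr pr + dot q q))
    <= quad X a b.
  rewrite XbE; apply: le_trans _ (lerD X1 X2).
  have := ler_wpM2l f1 main; have := ler_wpM2l fV rest; rewrite /quad !mulrDr.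
  by lra.
have nuE : (m - e) * (dot pr pr - dot q q) <= `|m - e| * (dot pr pr + dot q q).
  apply: le_trans (ler_norm _) _; rewrite normrM ler_wpM2l //.
  by rewrite ler_norml; apply/andP; split; lra.
have cE : h * c * (dot pr pr + dot q q) <= k * (dot pr pr + dot q q).
  rewrite ler_wpM2r ?addr_ge0 //; apply: le_trans (ltW hc).
  by rewrite ler_pM2l // lerDl.
have fmE : 0 <= h * (e - f * m) * dot pc pc.
  by rewrite !mulr_ge0 ?subr_ge0 // ltW.
have := ler_wpM2l (ltW h_gt0) XabE; have := ler_wpM2l (ltW h_gt0) nuE.
move: diag cE fmE; rewrite /c.
set T := \sum_l _; move: (dot pc pc) (dot pr pr) (dot q q) (quad X a b) T `|m - e| f^-1.
by move=> ec er eq Q T N F *; lra.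
Qed.

End Perturbation.

(** * Trace minimisation over symplectic frames *)

Section TraceMinimum.
Variable R : realType.
Local Notation J := (@sympJ R _).

Lemma symplecticmx_conj n (M : 'M[R]_(n + n)) : symplecticmx M -> M *m J *m M^T = J.
Proof.
move=> MJ; have : - (J *m (M^T *m J)) *m M = 1%:M.
  by rewrite mulNmx -mulmxA [_ *m M]MJ sympJJ opprK.
move=> /mulmx1C; rewrite mulmxN !mulmxA => /(congr1 (fun X => X *m J)).
by rewrite /= mulNmx -(mulmxA _ J J) sympJJ mulmxN mulmx1 mul1mx opprK.
Qed.

Lemma symplecticmx_inv n (M : 'M[R]_(n + n)) : symplecticmx M -> symplecticmx (invmx M).
Proof.
move=> MJ; have MU := symplectic_unit MJ; rewrite /symplecticmx -[in LHS]MJ.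
by rewrite trmx_inv !mulmxA mulVmx ?unitmx_tr // mul1mx mulmxK.
Qed.

(** The defect in [dot p p + dot q q >= 2]; it vanishes exactly when [p = J *m q]. *)
Lemma symplectic_pair_norm n (p q : 'cV[R]_(n + n)) : dot p (J *m q) = 1 ->
  dot (p - J *m q) (p - J *m q) = dot p p + dot q q - 2.
Proof.
move=> pq; rewrite !(dotDl, dotDr, dotNl, dotNr) dotJJ (dotC (J *m q) p) pq.
by lra.
Qed.

Lemma sympJ_delta n (l : 'I_n) :
  J *m delta_mx (rshift n l) 0 = delta_mx (lshift n l) 0 :> 'cV[R]_(n + n).
Proof.
apply: eq_col_halves => i; have [-> ->] := @mul_sympJ R n (delta_mx (rshift n l) 0) i.
by rewrite !mxE ?eq_lshift ?eq_rshift ?eq_lrshift ?eq_rlshift ?andbT oppr0.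
Qed.

Lemma dot_delta n i (x : 'cV[R]_(n + n)) : dot (delta_mx i 0) x = x i 0.
Proof. by rewrite /dot trmx_delta -rowE mxE. Qed.

Lemma mulmx_diagE n k (F : 'M[R]_(n + n, k + k)) i :
  (F^T *m F) i i = dot (F *m delta_mx i 0) (F *m delta_mx i 0).
Proof. by rewrite dotMl mulmxA dot_delta -colE [RHS]mxE. Qed.

Lemma frame_pair n k (F : 'M[R]_(n + n, k + k)) l : F^T *m J *m F = J ->
  dot (F *m delta_mx (lshift k l) 0) (J *m (F *m delta_mx (rshift k l) 0)) = 1.
Proof.
move=> FJ; rewrite dot_congr FJ sympJ_delta dot_delta !mxE !eqxx.
by [].
Qed.

Lemma mxtrace_split k (X : 'M[R]_(k + k)) :
  \tr X = \sum_l (X (lshift k l) (lshift k l) + X (rshift k l) (rshift k l)).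
Proof. by rewrite /mxtrace big_split_ord big_split. Qed.

Lemma mxtrace_dsum k (d : 'rV[R]_k) X : \tr (dsum d *m X) =
  \sum_l d 0 l * (X (lshift k l) (lshift k l) + X (rshift k l) (rshift k l)).
Proof.
rewrite mxtrace_split; apply: eq_bigr => l _.
have [-> _] := mul_dsum d X l (lshift k l); have [_ ->] := mul_dsum d X l (rshift k l).
by rewrite mulrDr.
Qed.

(** [X^T] is symplectic too, so the squared norms of rows [l] and [k + l] of [X] add up to at least
    2; the trace weights these sums by [b]. *)
Lemma symplectic_trace_ge k (X : 'M[R]_(k + k)) (b : 'rV[R]_k) :
  symplecticmx X -> (forall l, 0 < b 0 l) ->
  2 * \sum_l b 0 l <= \tr (X^T *m dsum b *m X).
Proof.
move=> /symplecticmx_conj XJ b_gt0; rewrite -mulmxA mxtrace_mulC -mulmxA mxtrace_dsum.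
have XTJ : (X^T)^T *m J *m X^T = J by rewrite trmxK.
rewrite mulr_sumr ler_sum // => l _; rewrite mulrC.
rewrite -{1 3}[X]trmxK !mulmx_diagE ler_pM2l // -subr_ge0 -symplectic_pair_norm ?dot_ge0 //.
exact: frame_pair XTJ.
Qed.

Lemma frame_inj n k (F : 'M[R]_(n + n, k + k)) (x : 'cV[R]_(k + k)) :
  F^T *m J *m F = J -> F *m x = 0 -> x = 0.
Proof.
move=> FJ Fx; have := congr1 (fun z => J *m (F^T *m J *m z)) Fx.
by rewrite /= mulmxA mulmx0 mulmx0 !mulmxA -(mulmxA J) -(mulmxA J) FJ sympJJ mulNmx mul1mx
  => /eqP; rewrite oppr_eq0 => /eqP.
Qed.

Lemma posdefmx_frame n k (A : 'M[R]_(n + n)) (F : 'M[R]_(n + n, k + k)) :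
  posdefmx A -> F^T *m J *m F = J -> posdefmx (F^T *m A *m F).
Proof.
move=> [A_sym A_gt0] FJ; split=> [|x x0]; first by rewrite !trmx_mul trmxK A_sym mulmxA.
rewrite -dot_congr A_gt0 //; apply: contra x0 => /eqP Fx; apply/eqP.
exact: frame_inj Fx.
Qed.

Lemma le_sympeig_frame n k (k_le_n : (k <= n)%N) (B : 'M[R]_(n + n))
    (F : 'M[R]_(n + n, k + k)) j : posdefmx B -> F^T *m J *m F = J ->
  sympeig B (widen_ord k_le_n j) <= sympeig (F^T *m B *m F) j.
Proof.
move=> B_pos FJ; have [d_gt0 d_sorted [M [MJ MB]]] := sympeigP B_pos.
have [_ b_sorted [L [LJ LN]]] := sympeigP (posdefmx_frame B_pos FJ).
have FLJ : (F *m L)^T *m J *m (F *m L) = J by rewrite -[RHS]LJ -FJ trmx_mul !mulmxA.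
have FLB : (F *m L)^T *m B *m (F *m L) = dsum (\row_j sympeig (F^T *m B *m F) j).
  by rewrite -LN trmx_mul !mulmxA.
have := le_sympeig_diag k_le_n j MJ MB d_sorted d_gt0 FLJ FLB b_sorted (fun x => lexx _).
by rewrite !mxE.
Qed.

Lemma trace_ge_sum_sympeig n (N : 'M[R]_(n + n)) : posdefmx N ->
  2 * \sum_j sympeig N j <= \tr N.
Proof.
move=> N_pos; have [b_gt0 _ [L [LJ LN]]] := sympeigP N_pos.
have := symplectic_trace_ge (symplecticmx_inv LJ) b_gt0.
rewrite -LN !mulmxA mulmxK ?symplectic_unit // trmx_inv mulVmx ?unitmx_tr ?symplectic_unit //.
by rewrite mul1mx; under eq_bigr do rewrite mxE.
Qed.

Lemma trace_frame_ge n k (k_le_n : (k <= n)%N) (B : 'M[R]_(n + n))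
    (F : 'M[R]_(n + n, k + k)) : posdefmx B -> F^T *m J *m F = J ->
  2 * \sum_(j < k) sympeig B (widen_ord k_le_n j) <= \tr (F^T *m B *m F).
Proof.
move=> B_pos FJ; apply: le_trans (trace_ge_sum_sympeig (posdefmx_frame B_pos FJ)).
by rewrite ler_pM2l // ler_sum // => j _; exact: le_sympeig_frame.
Qed.

Lemma sympeig_dsum n (d : 'rV[R]_n) j : (forall l, 0 < d 0 l) -> sorted_row d ->
  sympeig (dsum d) j = d 0 j.
Proof.
move=> d_gt0 d_sorted; apply: sympeigE; split=> //; exists 1%:M.
by rewrite /symplecticmx trmx1 !mul1mx !mulmx1.
Qed.

(** Minimal trace makes [X] the real form of a complex isometry, so what remains is the equality
    case of a Hermitian trace minimisation. *)
Lemma tight_frame_complex n k (k_le_n : (k <= n)%N) (d : 'rV[R]_n) (X : 'M[R]_(n + n, k + k)) :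
  (forall l, 0 < d 0 l) -> sorted_row d -> X^T *m J *m X = J ->
  \tr (X^T *m dsum d *m X) <= 2 * \sum_(j < k) d 0 (widen_ord k_le_n j) ->
  J *m X = X *m J /\ X^T *m X = 1%:M.
Proof.
move=> d_gt0 d_sorted XJ trX.
have [e e_gt0 ed] := pos_uniform (fun l => d 0 l).
(* Comparing the trace bounds of [d] and of [d - c] bounds the trace of [X^T X]. *)
pose c := e / 2; pose d' : 'rV[R]_n := \row_l (d 0 l - c).
have d'_gt0 l : 0 < d' 0 l by rewrite mxE /c; have := ed l (d_gt0 l); lra.
have d'_sorted : sorted_row d' by move=> j1 j2 /d_sorted; rewrite !mxE lerD2r.
have := trace_frame_ge k_le_n (posdefmx_dsum d'_gt0) XJ.
under eq_bigr do rewrite sympeig_dsum // mxE.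
have -> : dsum d' = dsum d - c%:M.
  rewrite scalar_mx_block opp_block_mx add_block_mx !oppr0 !addr0.
  suff -> : diag_mx d' = diag_mx d - c%:M by [].
  by apply/matrixP => i j; rewrite !mxE; case: eqP; rewrite ?mulr1n ?mulr0n ?subr0.
rewrite mulmxBr mulmxBl linearB /= mul_mx_scalar -scalemxAl mxtraceZ.
rewrite sumrB sumr_const card_ord.
have c_gt0 : 0 < c by rewrite divr_gt0.
move=> h; have {h} : \tr (X^T *m X) <= k%:R * 2.
  rewrite -(ler_pM2l c_gt0); rewrite -mulr_natr in h; lra.
(* The bound [2 k] is the minimum, reached only when every [gap] vanishes. *)
pose gap (l : 'I_k) : 'cV[R]_(n + n) :=
  X *m delta_mx (lshift k l) 0 - J *m (X *m delta_mx (rshift k l) 0).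
have gapE l : dot (gap l) (gap l) = (X^T *m X) (lshift k l) (lshift k l) +
   (X^T *m X) (rshift k l) (rshift k l) - 2.
  by rewrite symplectic_pair_norm ?frame_pair // !mulmx_diagE.
have -> : \tr (X^T *m X) = k%:R * 2 + \sum_l dot (gap l) (gap l).
  rewrite mxtrace_split; under [in RHS]eq_bigr do rewrite gapE.
  by rewrite sumrB sumr_const card_ord -[2 *+ k]mulr_natl addrC subrK.
rewrite -{2}[k%:R * 2]addr0 lerD2l => gap_le0.
have gap0 l : X *m delta_mx (lshift k l) 0 = J *m (X *m delta_mx (rshift k l) 0)
    :> 'cV[R]_(n + n).
  suff : dot (gap l) (gap l) == 0 by rewrite dot_eq0 subr_eq0 => /eqP.
  have /allP /(_ l (mem_index_enum l)) // :
      all (fun l => true ==> (dot (gap l) (gap l) == 0)) (index_enum 'I_k).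
  rewrite -psumr_eq0 => [|i _]; last exact: dot_ge0.
  by rewrite eq_le gap_le0 sumr_ge0 // => i _; exact: dot_ge0.
have JX : J *m X = X *m J.
  have cols i : J *m X *m delta_mx i 0 = X *m J *m delta_mx i 0 :> 'cV_(n + n).
    rewrite -(fintype.splitK i) -!mulmxA; case: (fintype.split i) => l /=.
      by rewrite gap0 -sympJ_delta !sympJK mulmxN.
    by rewrite -gap0 sympJ_delta.
  by apply/matrixP => a i; have /colP/(_ a) := cols i; rewrite -!colE !(mxE _ _ a 0).
split=> //; move: XJ; rewrite -mulmxA JX mulmxA => /(congr1 (fun Z => Z *m J)).
by rewrite /= -mulmxA sympJJ mulmxN mulmx1 => /oppr_inj.
Qed.

(** The equality case of Ky Fan's minimum principle. The diagonal [s] of the projection [X *m X^T]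
    lies in [0, 1], and [low] is its sum over each pair for the span of the first [k] pairs. With
    the threshold [c = d_k] every term [(d_l - c) * (S l - low l)] is nonnegative, so minimality
    kills it: coordinates with [d_l < c] lie in the span, those with [d_l > c] are orthogonal to it,
    and [dsum d - c] vanishes on the others. *)
Lemma tight_frame_invariant n k (k_le_n : (k <= n)%N) (k_gt0 : (0 < k)%N) (d : 'rV[R]_n)
    (X : 'M[R]_(n + n, k + k)) :
  (forall l, 0 < d 0 l) -> sorted_row d -> X^T *m J *m X = J ->
  \tr (X^T *m dsum d *m X) <= 2 * \sum_(j < k) d 0 (widen_ord k_le_n j) ->
  dsum d *m X = X *m (X^T *m dsum d *m X).
Proof.
move=> d_gt0 d_sorted XJ trX.
have [JX XX] := tight_frame_complex d_gt0 d_sorted XJ trX.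
have k1 : (k.-1 < k)%N by rewrite prednK.
pose c := d 0 (widen_ord k_le_n (Ordinal k1)).
pose P := 1%:M - X *m X^T.
have PX : P *m X = 0 by rewrite mulmxBl mul1mx -mulmxA XX mulmx1 subrr.
have PT : P^T = P by rewrite linearB /= trmx1 trmx_mul trmxK.
have PP : P^T *m P = P by rewrite PT {2}/P mulmxBr mulmx1 mulmxA PX mul0mx subr0.
pose s i := (X *m X^T) i i.
have sqE a b (Y : 'M[R]_(a, b)) i : (Y^T *m Y) i i = \sum_j Y j i ^+ 2.
  by rewrite mxE; apply: eq_bigr => j _; rewrite mxE expr2.
have sP i : P i i = 1 - s i by rewrite /s /P !mxE eqxx.
have s_le1 i : s i <= 1.
  by rewrite -subr_ge0 -sP -PP sqE sumr_ge0 // => j _; exact: sqr_ge0.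
have sX i : s i = \sum_j X i j ^+ 2.
  by rewrite /s -{1}[X]trmxK sqE; apply: eq_bigr => j _; rewrite mxE.
have s_ge0 i : 0 <= s i by rewrite sX sumr_ge0 // => j _; exact: sqr_ge0.
have sq_sum0 (I : finType) (f : I -> R) : \sum_j f j ^+ 2 = 0 -> forall j, f j = 0.
  move=> /eqP; rewrite psumr_eq0 => [/allP h j|j _]; last exact: sqr_ge0.
  by have := h j (mem_index_enum j); rewrite /= sqrf_eq0 => /eqP.
pose S l := s (lshift n l) + s (rshift n l).
pose low (l : 'I_n) : R := ((l < k)%N)%:R * 2.
have sum_low (f : 'I_n -> R) : \sum_l f l * low l = 2 * \sum_(j < k) f (widen_ord k_le_n j).
  rewrite -(big_ord_narrow k_le_n) [in RHS]big_mkcond mulr_sumr; apply: eq_bigr => l _.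
  by rewrite /low; case: ifP => _; rewrite ?mul0r ?mul1r ?mulr0 // mulrC.
have trXX : \sum_(l < n) S l = \sum_(l < n) low l.
  have := sum_low (fun => 1); under eq_bigr do rewrite mul1r.
  rewrite sumr_const card_ord => ->.
  by rewrite -mxtrace_split mxtrace_mulC XX mxtrace1 natrD mulr_natl mulr2n.
have trXd : \sum_l d 0 l * S l <= \sum_l d 0 l * low l.
  rewrite sum_low; apply: le_trans trX.
  by rewrite -mulmxA mxtrace_mulC -mulmxA mxtrace_dsum.
have term_ge0 l : 0 <= (d 0 l - c) * (S l - low l).
  have := s_le1 (lshift n l); have := s_le1 (rshift n l).
  rewrite /low; case: ltnP => lk h1 h2.
    apply: mulr_le0; last by rewrite /S mul1r; lra.
    by rewrite subr_le0 d_sorted //= -ltnS prednK.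
  rewrite mul0r subr0; apply: mulr_ge0; last by rewrite addr_ge0.
  rewrite subr_ge0 d_sorted //=.
  by rewrite (leq_trans _ lk) // leq_pred.
have term0 l : (d 0 l - c) * (S l - low l) = 0.
  have : \sum_l (d 0 l - c) * (S l - low l) <= 0.
    under eq_bigr do rewrite mulrBl !mulrBr opprB.
    rewrite !big_split /= !sumrN -!mulr_sumr trXX.
    by move: trXd; lra.
  move=> sum_le0; have /allP /(_ l (mem_index_enum l)) /= /eqP // :
    all (fun l => true ==> ((d 0 l - c) * (S l - low l) == 0)) (index_enum 'I_n).
  by rewrite -psumr_eq0 // eq_le sum_le0 sumr_ge0.
have PdX : P *m ((dsum d - c%:M) *m X) = 0.
  have colP0 i : s i = 1 -> forall a, P a i = 0.
    by move=> si; apply: sq_sum0; rewrite -sqE PP sP si subrr.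
  have rowX0 i : s i = 0 -> forall b, X i b = 0.
    by move=> si; apply: sq_sum0; rewrite -sX si.
  have both l a b :
      P a (lshift n l) * ((dsum d - c%:M) *m X) (lshift n l) b = 0 /\
      P a (rshift n l) * ((dsum d - c%:M) *m X) (rshift n l) b = 0.
    rewrite mulmxBl mul_scalar_mx ![(_ - c *: X) _ _]mxE.
    have [-> ->] := mul_dsum d X l b; rewrite ![(- (c *: X)) _ _]mxE ![(c *: X) _ _]mxE.
    have /eqP := term0 l; rewrite mulf_eq0 !subr_eq0 => /orP[/eqP ->|].
      by rewrite !subrr !mulr0.
    have := s_le1 (lshift n l); have := s_le1 (rshift n l).
    have := s_ge0 (lshift n l); have := s_ge0 (rshift n l).
    rewrite /low /S; case: ltnP => _ h1 h2 h3 h4 /eqP; rewrite ?mul1r ?mul0r => h5.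
      by rewrite !colP0 ?mul0r //; lra.
    by rewrite !rowX0 ?mulr0 ?subrr ?mulr0 //; lra.
  apply/matrixP => a b; rewrite mxE big_split_ord /= [RHS]mxE.
  by rewrite !big1 ?addr0 // => l _; have [] := both l a b.
move: PdX; rewrite [(_ - c%:M) *m X]mulmxBl mul_scalar_mx mulmxBr -scalemxAr PX scaler0 subr0.
by rewrite mulmxBl mul1mx => /eqP; rewrite subr_eq0 !mulmxA => /eqP.
Qed.

Lemma trace_eq_invariant n k (k_le_n : (k <= n)%N) (k_gt0 : (0 < k)%N)
    (B : 'M[R]_(n + n)) (F : 'M[R]_(n + n, k + k)) :
  posdefmx B -> F^T *m J *m F = J ->
  \tr (F^T *m B *m F) <= 2 * \sum_(j < k) sympeig B (widen_ord k_le_n j) ->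
  exists Y, J *m B *m F = F *m Y.
Proof.
move=> B_pos FJ trF; have [d_gt0 d_sorted [M [MJ MB]]] := sympeigP B_pos.
have [X FX] : exists X, F = M *m X.
  by exists (invmx M *m F); rewrite mulKVmx ?symplectic_unit.
have XJ : X^T *m J *m X = J.
  by rewrite -[RHS]FJ FX trmx_mul -{1}MJ !mulmxA.
have trX : \tr (X^T *m dsum (\row_j sympeig B j) *m X) <=
    2 * \sum_(j < k) (\row_j sympeig B j) 0 (widen_ord k_le_n j).
  under eq_bigr do rewrite mxE.
  by rewrite -MB; move: trF; rewrite FX trmx_mul !mulmxA.
have [W dX] : exists W, dsum (\row_j sympeig B j) *m X = X *m W.
  by have dX := tight_frame_invariant k_gt0 d_gt0 d_sorted XJ trX; eexists; exact: dX.
have JB : J *m B *m M = M *m J *m dsum (\row_j sympeig B j).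
  by rewrite -[in LHS](symplecticmx_conj MJ) -MB !mulmxA.
exists (J *m W); rewrite FX !mulmxA JB -!mulmxA dX.
have [JX _] := tight_frame_complex d_gt0 d_sorted XJ trX.
by rewrite (mulmxA J X) JX !mulmxA.
Qed.
End TraceMinimum.

(** * From local slopes to increments *)

(** For each [m < c], the set of points up to [t] reached with mean slope at least [m] contains its
    supremum, because [f] is nondecreasing; the local bound with [e = c - m] would push past a
    supremum below [t]. *)
Lemma slope_lower_bound (R : realType) (f : R -> R) (c : R) :
  (forall s t, 0 <= s -> s <= t -> t <= 1 -> f s <= f t) ->
  (forall s e, 0 <= s -> s < 1 -> 0 < e -> exists2 h0, 0 < h0 &
     forall h, 0 < h < h0 -> f s + h * (c - e) <= f (s + h)) ->
  forall s t, 0 <= s -> s <= t -> t <= 1 -> f s + c * (t - s) <= f t.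
Proof.
move=> f_mono f_slope s t s0 st t1.
apply/ler_addgt0Pr => e e_gt0.
suff slope m : m < c -> f s + m * (t - s) <= f t.
  have ce : c - e < c by rewrite ltrBlDr ltrDl.
  have : e * (t - s) <= e by apply: ler_piMr; [exact: ltW | lra].
  by have := slope _ ce; lra.
move=> mc; pose E := [set x | s <= x <= t /\ f s + m * (x - s) <= f x]%classic.
have Es : E s by split; rewrite ?lexx ?st // subrr mulr0 addr0.
have E_ub : ubound E t by move=> x [/andP[]].
have E_sup : has_sup E by split; [exists s | exists t].
have su : s <= sup E by apply: sup_upper_bound.
have ut : sup E <= t by apply: sup_le_ub => //; exists s.
have Eu : E (sup E).
  split; first by rewrite su ut.
  apply/ler_addgt0Pr => r r_gt0.
  have m1_gt0 : 0 < `|m| + 1 by rewrite ltr_wpDl.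
  have [x [/andP[sx xt] fx] ux] := sup_adherent (divr_gt0 r_gt0 m1_gt0) E_sup.
  have xu : x <= sup E by apply: sup_upper_bound => //; split; rewrite ?sx.
  have fxu : f x <= f (sup E) by apply: f_mono; rewrite ?(le_trans s0) ?(le_trans ut).
  have : m * (sup E - x) <= r.
    apply: le_trans (ler_norm _) _; rewrite normrM.
    rewrite -[r](divfK (lt0r_neq0 m1_gt0)) mulrC; apply: ler_pM => //.
      by rewrite ger0_norm ?subr_ge0 // lerBlDl -lerBlDr ltW.
    by rewrite lerDl.
  by move: fx fxu; lra.
have [tu|ut'] := leP t (sup E).
  have -> : t = sup E by apply/le_anti; rewrite tu ut.
  exact: Eu.2.
have cm : 0 < c - m by rewrite subr_gt0.
have [h0 h0_gt0 h0P] := f_slope _ _ (le_trans s0 su) (lt_le_trans ut' t1) cm.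
pose h := Num.min (h0 / 2) (t - sup E).
have h_gt0 : 0 < h by rewrite lt_min divr_gt0 // subr_gt0.
have h_lt : 0 < h < h0.
  by rewrite h_gt0 gt_min; apply/orP; left; lra.
have ht : sup E + h <= t by rewrite -lerBrDl ge_min lexx orbT.
suff /(sup_upper_bound E_sup) : E (sup E + h) by rewrite gerDl leNgt h_gt0.
split; first by rewrite ht (le_trans su) // lerDl ltW.
by have := h0P h h_lt; have := Eu.2; rewrite opprB (addrC c) subrK; lra.
Qed.

(** * Frames of selected symplectic eigenvectors *)

Section Subframe.
Variables (R : realType) (n k : nat) (i : 'I_k -> 'I_n).
Hypothesis i_inj : injective i.
Local Notation J := (@sympJ R _).

Definition select_mx : 'M[R]_(n, k) := \matrix_(a, j) (a == i j)%:R.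
Local Notation E := select_mx.
Local Notation S := (block_mx E 0 0 E).

Lemma select_mx_diag (d : 'rV[R]_n) :
  diag_mx d *m E = E *m diag_mx (\row_j d 0 (i j)).
Proof.
rewrite mul_diag_mx mul_mx_diag; apply/matrixP => a j; rewrite !mxE.
by case: eqP => [->|_]; [rewrite mulrC | rewrite mul0r mulr0].
Qed.

Lemma select_mx_trmx : E^T *m E = 1%:M.
Proof.
apply/matrixP => a b; rewrite !mxE (bigD1 (i a)) //= !mxE eqxx mul1r.
rewrite big1 => [|j /negPf ja]; last by rewrite !mxE ja mul0r.
by rewrite addr0 (inj_eq i_inj).
Qed.

Lemma selectT : S^T = block_mx E^T 0 0 E^T.
Proof. by rewrite tr_block_mx !trmx0. Qed.

Lemma select_sympJ : J *m S = S *m J.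
Proof.
rewrite !mulmx_block !(mul0mx, mulmx0, addr0, add0r) mul1mx mulmx1.
by rewrite mulmxN mulNmx mul1mx mulmx1.
Qed.

Lemma select_dsum (d : 'rV[R]_n) : dsum d *m S = S *m dsum (\row_j d 0 (i j)).
Proof.
by rewrite !mulmx_block !(mul0mx, mulmx0, addr0, add0r) select_mx_diag.
Qed.

Lemma select_trmx : S^T *m S = 1%:M.
Proof.
rewrite selectT mulmx_block !(mul0mx, mulmx0, addr0, add0r) select_mx_trmx.
by rewrite -scalar_mx_block.
Qed.

Lemma mxtrace_select X : \tr (S^T *m X *m S) =
  \sum_j (X (lshift n (i j)) (lshift n (i j)) + X (rshift n (i j)) (rshift n (i j))).
Proof.
have blk (Y : 'M[R]_n) : \tr (E^T *m Y *m E) = \sum_j Y (i j) (i j).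
  apply: eq_bigr => j _; rewrite mxE (bigD1 (i j)) //= [E _ _]mxE eqxx mulr1.
  rewrite [in LHS]big1 ?addr0 => [|a /negPf aj]; last by rewrite [E _ _]mxE aj mulr0.
  rewrite mxE (bigD1 (i j)) //= !mxE eqxx mul1r.
  by rewrite big1 ?addr0 // => a /negPf aj; rewrite !mxE aj mul0r.
rewrite selectT -[X]submxK !mulmx_block !(mul0mx, mulmx0, addr0, add0r).
rewrite mxtrace_block !blk -big_split; apply: eq_bigr => j _.
by rewrite !block_mxEul !block_mxEdr.
Qed.

Lemma adapted_frame (A B : 'M[R]_(n + n)) : posdefmx A -> posdefmx B ->
  exists (F : 'M[R]_(n + n, k + k)) (mu : 'I_k -> R),
  [/\ F^T *m J *m F = J,
      F^T *m A *m F = dsum (\row_j sympeig A (i j)),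
      exists Y, J *m A *m F = F *m Y,
      \tr (F^T *m B *m F) = 2 * \sum_j mu j &
      forall j e, 0 < e -> exists2 h0, 0 < h0 & forall h, 0 < h < h0 ->
        sympeig A (i j) + h * (mu j - e) <= sympeig (A + h *: B) (i j)].
Proof.
move=> A_pos B_pos; have [M [mu [MJ MA mu_sorted MB]]] := adapted_williamson A_pos B_pos.1.
have congr X : (M *m S)^T *m X *m (M *m S) = S^T *m (M^T *m X *m M) *m S.
  by rewrite trmx_mul !mulmxA.
exists (M *m S), (fun j => mu 0 (i j)); split.
- by rewrite congr [X in _ *m X *m _]MJ -mulmxA select_sympJ mulmxA select_trmx mul1mx.
- rewrite congr MA -mulmxA select_dsum mulmxA select_trmx mul1mx.
  by congr (dsum _); apply/rowP => j; rewrite !mxE.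
- have JA : J *m A *m M = M *m J *m dsum (\row_j sympeig A j).
    by rewrite -[in LHS](symplecticmx_conj MJ) -MA !mulmxA.
  exists (J *m dsum (\row_j (\row_l sympeig A l) 0 (i j))).
  by rewrite mulmxA JA -!mulmxA select_dsum (mulmxA J) select_sympJ !mulmxA.
- rewrite congr mxtrace_select mulr_sumr; apply: eq_bigr => j _.
  (* [J *m y] is the left unit vector of pair [l], so [MB] at [y] reads off both diagonal entries of
     [M^T *m B *m M]. *)
  set l := i j; pose y : 'cV[R]_(n + n) := delta_mx (rshift n l) 0.
  have yE m : energy m y = (m == l)%:R.
    rewrite /energy /y !mxE eq_lrshift eq_rshift andbT expr0n add0r.
    by case: eqP; rewrite ?expr1n ?expr0n.
  have := MB (sympeig A l) y (sympeig_gt0 _ A_pos).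
  rewrite quad_congr /quad sympJ_delta !dot_delta -!colE ![col _ _ _ _]mxE addrC => ->.
    rewrite (bigD1 l) //= yE eqxx mulr1 big1 ?addr0 // => m /negPf ml.
    by rewrite yE ml mulr0.
  by move=> m; rewrite yE; case: (m =P l) => [->|//]; rewrite eqxx.
- move=> j e e_gt0; exact: (sympeig_perturb (i j) A_pos B_pos MJ MA mu_sorted MB e_gt0).
Qed.

End Subframe.

(** * The invariant subspace *)

(** In Williamson coordinates the two equations give [c_l ^ 2 = d ^ 2] wherever [x] has a nonzero
    coordinate in pair [l], and both numbers are positive. *)
Lemma sympeigpair_exists (R : realType) n (C : 'M[R]_(n + n)) (d : R)
    (u v : 'cV[R]_(n + n)) : posdefmx C -> 0 < d -> u != 0 ->
  C *m u = d *: (sympJ *m v) -> C *m v = - d *: (sympJ *m u) -> exists m, d = sympeig C m.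
Proof.
move=> C_pos d_gt0; have [c_gt0 _ [M [MJ MC]]] := sympeigP C_pos.
have MK (x : 'cV_(n + n)) : exists y, x = M *m y.
  by exists (invmx M *m x); rewrite mulKVmx // symplectic_unit.
have [[x ->] [y ->]] := (MK u, MK v) => Mx0 Cx Cy.
set c := \row_j _ in c_gt0 MC.
have dx : dsum c *m x = d *: (sympJ *m y) by rewrite -MC -!mulmxA Cx -scalemxAr !mulmxA MJ.
have dy : dsum c *m y = - d *: (sympJ *m x) by rewrite -MC -!mulmxA Cy -scalemxAr !mulmxA MJ.
have [[m ->]|no_m] := pselect (exists m, d = sympeig C m); first by exists m.
case/negP: Mx0; apply/eqP; rewrite (_ : x = 0) ?mulmx0 //.
apply: eq_col_halves => l; rewrite !mxE.
have cd : c 0 l ^+ 2 - d ^+ 2 != 0.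
  rewrite subr_eq0 eqrXn2 ?ltW //; apply/eqP => cd; apply: no_m; exists l.
  by rewrite -cd mxE.
have [dx1 dx2] := mul_dsum c x l 0; have [dy1 dy2] := mul_dsum c y l 0.
move: dx1 dx2 dy1 dy2.
rewrite dx dy ![(d *: (sympJ *m y)) _ _]mxE ![(- d *: (sympJ *m x)) _ _]mxE.
have [-> ->] := mul_sympJ x l; have [-> ->] := mul_sympJ y l.
move: (c 0 l) cd => e ed h1 h2 h3 h4.
have sq (w : R) : e * (e * w) = d * (d * w) -> w = 0.
  by move=> ew; apply: (mulfI ed); rewrite mulr0 mulrBl !expr2 -!mulrA ew subrr.
split; apply: sq.
  by rewrite -h1 mulrCA -h4; ring.
by rewrite -h2 mulrCA mulrN -h3; ring.
Qed.

Section FrameSpan.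
Variables (R : realType) (n k : nat) (F : 'M[R]_(n + n, k + k)).
Local Notation J := (@sympJ R _).
Hypothesis FJ : F^T *m J *m F = J.

Definition frame_span : {vspace 'cV[R]_(n + n)} :=
  limg (linfun (mulmx F : 'cV[R]_(k + k) -> 'cV[R]_(n + n))).

Lemma frame_spanP x : reflect (exists y, x = F *m y) (x \in frame_span).
Proof.
apply: (iffP memv_imgP) => [[y _ ->]|[y ->]]; exists y; rewrite ?lfunE ?memvf //.
Qed.

Lemma dim_frame_span : \dim frame_span = (2 * k)%N.
Proof.
have := limg_ker_dim (linfun (mulmx F : 'cV[R]_(k + k) -> 'cV[R]_(n + n))) fullv.
have -> : lker (linfun (mulmx F : 'cV[R]_(k + k) -> 'cV[R]_(n + n))) = 0%VS.
  apply/eqP; rewrite -subv0; apply/subvP => y.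
  by rewrite memv_ker lfunE memv0 => /eqP /(frame_inj FJ) ->.
rewrite capv0 dimv0 add0n dimvf /frame_span => ->.
by rewrite /dim /= muln1; lia.
Qed.

Lemma symplectic_frame_span : symplectic_subspace frame_span.
Proof.
move=> _ /frame_spanP[y ->] Fy; exists (F *m (J *m y)); first by apply/frame_spanP; exists (J *m y).
rewrite dot_congr FJ sympJK dotNr oppr_eq0 dot_eq0.
by apply: contra Fy => /eqP ->; rewrite mulmx0.
Qed.

Lemma invariant_frame_span X Y : X *m F = F *m Y -> invariant_subspace X frame_span.
Proof.
move=> XF _ /frame_spanP[y ->]; apply/frame_spanP; exists (Y *m y).
by rewrite !mulmxA XF.
Qed.

Lemma symplectic_basis_frame (L : 'M[R]_(k + k)) : symplecticmx L ->
  symplectic_basis frame_span (fun j => col (lshift k j) (F *m L))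
                              (fun j => col (rshift k j) (F *m L)).
Proof.
move=> LJ; pose G := F *m L.
have GJ : G^T *m J *m G = J by rewrite -[RHS]LJ -FJ trmx_mul !mulmxA.
have dotG a b : dot (col a G) (J *m col b G) = (J : 'M[R]_(k + k)) a b.
  by rewrite !colE dot_congr GJ dot_delta -colE mxE.
split; last 1 first.
- move=> i j /negPf ij; rewrite !dotG /sympJ.
  by rewrite block_mxEur block_mxEul block_mxEdr !mxE ij.
- rewrite basisEdim dim_frame_span size_cat !size_image card_ord.
  apply/andP; split; last by rewrite mul2n addnn.
  apply/subvP => _ /frame_spanP[y ->].
  have -> : F *m y = G *m (invmx L *m y) by rewrite /G -mulmxA mulKVmx ?symplectic_unit.
  move: (invmx L *m y) => z.
  have -> : G *m z = \sum_a z a 0 *: col a G.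
    apply/colP => b; rewrite mxE summxE; apply: eq_bigr => a _.
    by rewrite !mxE mulrC.
  apply: memv_suml => a _; apply/memvZ/memv_span; rewrite mem_cat.
  rewrite -(fintype.splitK a); case: (fintype.split a) => l /=; apply/orP; [left|right];
    by apply/fintype.imageP; exists l.
- by move=> i; rewrite dotG block_mxEur mxE eqxx.
Qed.

(** By invariance the Williamson basis [L] of the compression lifts to [G = F *m L]:
    [J *m C *m G = G *m Z] together with [G^T *m C *m G = dsum b] gives [Z = J *m dsum b], the
    eigenvector equations for the columns of [G]. *)
Lemma frame_span_sympeig (C : 'M[R]_(n + n)) Y : posdefmx C -> J *m C *m F = F *m Y ->
  sympeig_basis C frame_span (sympeig (F^T *m C *m F)).
Proof.
move=> C_pos CF; have N_pos := posdefmx_frame C_pos FJ.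
have [b_gt0 _ [L [LJ LN]]] := sympeigP N_pos; set b := \row_j _ in b_gt0 LN.
have bas := symplectic_basis_frame LJ; have [_ uv1 _] := bas.
have [G GE] : exists G, G = F *m L by exists (F *m L).
have GJ : G^T *m J *m G = J by rewrite GE -[RHS]LJ -FJ trmx_mul !mulmxA.
have GC : G^T *m C *m G = dsum b by rewrite GE -LN trmx_mul !mulmxA.
have [Z JCG] : exists Z, J *m C *m G = G *m Z.
  exists (invmx L *m Y *m L).
  by rewrite GE !mulmxA CF mulmxK // symplectic_unit.
rewrite -{}GE in bas uv1.
have CG : C *m G = - (J *m G *m Z) by rewrite -mulmxA -JCG !mulmxA sympJJ !mulNmx mul1mx opprK.
have ZE : Z = J *m dsum b.
  have -> : dsum b = - (J *m Z) by rewrite -GC -mulmxA CG mulmxN !mulmxA GJ.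
  by rewrite mulmxN mulmxA sympJJ mulNmx mul1mx opprK.
exists (fun j => col (lshift k j) G), (fun j => col (rshift k j) G); split=> // j.
have dsum_l : dsum b *m delta_mx (lshift k j) 0 = b 0 j *: delta_mx (lshift k j) 0 :> 'cV_(k + k).
  apply: eq_col_halves => l; have [-> ->] := @mul_dsum R k 1 b (delta_mx (lshift k j) 0) l 0.
  rewrite !mxE eq_lshift eq_rlshift.
  by case: (l =P j) => [->|_]; rewrite ?mulr0.
have dsum_r : dsum b *m delta_mx (rshift k j) 0 = b 0 j *: delta_mx (rshift k j) 0 :> 'cV_(k + k).
  apply: eq_col_halves => l; have [-> ->] := @mul_dsum R k 1 b (delta_mx (rshift k j) 0) l 0.
  rewrite !mxE eq_rshift eq_lrshift.
  by case: (l =P j) => [->|_]; rewrite ?mulr0.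
have Cu : C *m col (lshift k j) G = b 0 j *: (J *m col (rshift k j) G).
  rewrite !colE mulmxA CG ZE mulNmx -!mulmxA dsum_l -!scalemxAr.
  by rewrite -sympJ_delta sympJK !mulmxN scalerN opprK.
have Cv : C *m col (rshift k j) G = - b 0 j *: (J *m col (lshift k j) G).
  rewrite !colE mulmxA CG ZE mulNmx -!mulmxA dsum_r -!scalemxAr.
  by rewrite sympJ_delta scaleNr.
have bj : sympeig (F^T *m C *m F) j = b 0 j by rewrite mxE.
have u0 : col (lshift k j) G != 0.
  by apply/eqP => u0; have /eqP := uv1 j; rewrite u0 dot0l eq_sym oner_eq0.
have v0 : col (rshift k j) G != 0.
  by apply/eqP => v0; have /eqP := uv1 j; rewrite v0 mulmx0 dot0r eq_sym oner_eq0.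
by rewrite bj; split=> //; exact: sympeigpair_exists C_pos (b_gt0 j) u0 Cu Cv.
Qed.
End FrameSpan.

(** * Coincidences of eigenvalues along the line *)

Section Line.
Variables (R : realType) (n : nat) (A B : 'M[R]_(n + n)).
Hypotheses (A_pos : posdefmx A) (B_pos : posdefmx B).
Local Notation J := (@sympJ R _).
Local Notation line t := (A + t *: B).

(* [t] is chosen with the fewest coincidences among the symplectic eigenvalues, so
   that the coincidences at [t] persist nearby to the right. *)
Lemma stable_multiplicities : exists2 s : R, 0 < s < 1 & exists2 c, s < c < 1 &
  forall t, s <= t <= c ->
   (forall l m, sympeig (line s) l < sympeig (line s) m ->
      t / s * sympeig (line s) l < sympeig (line s) m) /\
   (forall l m, sympeig (line s) l = sympeig (line s) m ->
      sympeig (line t) l = sympeig (line t) m).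
Proof.
pose C t := [set p : 'I_n * 'I_n | sympeig (line t) p.1 == sympeig (line t) p.2]%SET.
have ex_card : exists N, `[< exists t : R, 0 < t < 1 /\ #|C t| = N >].
  by exists #|C (1 / 2)|; apply/asboolP; exists (1 / 2); split=> //; apply/andP; split; lra.
have [N /asboolP[s [/andP[s_gt0 s1] sN]] N_min] := ex_minnP ex_card.
pose D l := sympeig (line s) l.
have line_pos t : 0 <= t -> posdefmx (line t) by exact: posdefmx_addscale.
have D_gt0 l : 0 < D l by apply/sympeig_gt0/line_pos/ltW.
(* A lower bound for the relative gaps between distinct eigenvalues at [s]; [c] keeps [t / s] below
   [1 + r]. *)
have [r r_gt0 rD] := pos_uniform (fun p : 'I_n * 'I_n => D p.2 / D p.1 - 1).
pose c := Num.min ((s + 1) / 2) (s * (1 + r / 2)).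
have sc : s < c.
  rewrite lt_min; apply/andP; split; first by lra.
  by rewrite ltr_pMr //; lra.
have c1 : c < 1 by rewrite gt_min; apply/orP; left; lra.
exists s; first by rewrite s_gt0.
exists c; first by rewrite sc.
move=> t /andP[st tc].
have ts : t / s < 1 + r.
  rewrite ltr_pdivrMr //; apply: le_lt_trans tc _.
  rewrite gt_min; apply/orP; right; rewrite mulrC ltr_pM2r //; lra.
have gap l m : D l < D m -> t / s * D l < D m.
  move=> lm; have := rD (l, m); rewrite subr_gt0 /= ltr_pdivlMr ?mul1r // => /(_ lm).
  rewrite lerBrDr addrC ler_pdivlMr // => /(lt_le_trans _); apply.
  by rewrite ltr_pM2r.
split=> // l m lm.
have ray j := sympeig_ray j A_pos B_pos s_gt0 st.
have strict a b : D a < D b -> sympeig (line t) a < sympeig (line t) b.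
  move=> /gap ab; have /andP[_ h1] := ray a; have /andP[h2 _] := ray b.
  by apply: le_lt_trans h1 (lt_le_trans ab h2).
(* Strict inequalities at [s] persist at [t], so coincidences can only be lost; minimality of [N]
   excludes any loss. *)
have sub : C t \subset C s.
  apply/fintype.subsetP => p; rewrite !inE => /eqP tp.
  by case: (ltgtP (sympeig (line s) p.1) (sympeig (line s) p.2)) => // /strict;
    rewrite tp ltxx.
have CE : C t = C s.
  apply/eqP; rewrite eqEcard sub sN N_min //; apply/asboolP; exists t.
  by rewrite (lt_le_trans s_gt0) ?(le_lt_trans tc).
have : (l, m) \in C t by rewrite CE inE /= lm.
by rewrite inE => /eqP.
Qed.

End Line.

(** * The equality case of the sum inequality *)

Unset Implicit Arguments.

Theorem theorem3 (R : realType) (n k : nat) (A B : 'M[R]_(n + n))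
  (hA : posdefmx A) (hB : posdefmx B)
  (k_gt0 : (0 < k)%N) (k_le_n : (k <= n)%N) (i : 'I_k -> 'I_n)
  (i_incr : forall p q : 'I_k, (p < q)%N -> (i p < i q)%N)
  (hsum : \sum_(j < k) sympeig (A + B) (i j) =
          \sum_(j < k) sympeig A (i j)
          + \sum_(j < k) sympeig B (widen_ord k_le_n j)) :
  exists (r : nat) (U : 'I_r -> {vspace 'cV[R]_(n + n)}) (a : nat -> R),
    [/\ (0 < r)%N,
        forall l : 'I_r, \dim (U l) = (2 * k)%N /\ symplectic_subspace (U l)
      & [/\ a 0%N = 0, a r = 1 & forall l : 'I_r, a l < a l.+1]] /\
    [/\ (* (i) *)
        forall l : 'I_r, invariant_subspace (sympJ *m A) (U l) /\
                         invariant_subspace (sympJ *m B) (U l),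
        (* (ii) *)
        forall l : 'I_r,
          sympeig_basis B (U l) (fun j : 'I_k => sympeig B (widen_ord k_le_n j))
      & (* (iii) *)
        forall l : 'I_r, exists b c : R,
          [/\ a l <= b, b < c, c <= a l.+1
            & forall t : R, b <= t <= c ->
                associated_sympeigs (A + t *: B) (U l)
                  (fun j : 'I_k => sympeig (A + t *: B) (i j))]].
Proof.
have i_mono (p q : 'I_k) : (p <= q)%N -> (i p <= i q)%N.
  by rewrite leq_eqVlt => /orP[/eqP/val_inj -> //|/i_incr/ltnW].
have i_inj : injective i.
  move=> p q pq; apply: val_inj; case: (ltngtP p q) => // /i_incr;
  by rewrite pq ltnn.
pose f t := \sum_(j < k) sympeig (A + t *: B) (i j).
pose c0 := \sum_(j < k) sympeig B (widen_ord k_le_n j).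
have line_pos t : 0 <= t -> posdefmx (A + t *: B) by exact: posdefmx_addscale.
have lineD s h : A + s *: B + h *: B = A + (s + h) *: B by rewrite scalerDl addrA.
have f_mono s t : 0 <= s -> s <= t -> t <= 1 -> f s <= f t.
  move=> s0 st _; rewrite ler_sum // => j _; apply: le_sympeig.
  - exact: line_pos.
  - by apply: line_pos; exact: le_trans st.
  - by move=> x; rewrite !quad_addscale lerD2l ler_wpM2r ?posdefmx_ge0.
have f_lower s : 0 <= s -> exists F mu, [/\ F^T *m sympJ *m F = sympJ :> 'M[R]_(k + k),
    F^T *m (A + s *: B) *m F = dsum (\row_j sympeig (A + s *: B) (i j)),
    exists Y, sympJ *m (A + s *: B) *m F = F *m Y,
    \tr (F^T *m B *m F) = 2 * mu &
    forall e, 0 < e -> exists2 h0, 0 < h0 &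
      forall h, 0 < h < h0 -> f s + h * (mu - e) <= f (s + h)].
  move=> s0; have [F [mu [FJ FA FY FB F_low]]] := adapted_frame i_inj (line_pos s s0) hB.
  exists F, (\sum_j mu j); split=> // e e_gt0.
  (* The tolerance [e] is shared equally among the [k] eigenvalues. *)
  have ek : 0 < e / k%:R by rewrite divr_gt0 ?ltr0n.
  have low j : exists h0, 0 < h0 /\ forall h, 0 < h < h0 ->
      sympeig (A + s *: B) (i j) + h * (mu j - e / k%:R) <=
      sympeig (A + s *: B + h *: B) (i j).
    by have [h0 h0_gt0 h0P] := F_low j _ ek; exists h0.
  have [h0 h0P] := choice low; have [h1 h1_gt0 h1P] := pos_uniform h0.
  exists h1 => // h /andP[h_gt0 hh1].
  have -> : f s + h * (\sum_j mu j - e) =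
      \sum_j (sympeig (A + s *: B) (i j) + h * (mu j - e / k%:R)).
    rewrite big_split -mulr_sumr sumrB sumr_const card_ord -[_ *+ k]mulr_natr.
    by rewrite divfK // pnatr_eq0 -lt0n.
  rewrite /f ler_sum // => j _; have [h0_gt0 h0jP] := h0P j.
  by rewrite -lineD h0jP // h_gt0 (lt_le_trans hh1) ?h1P.
have f_slope s e : 0 <= s -> s < 1 -> 0 < e -> exists2 h0, 0 < h0 &
    forall h, 0 < h < h0 -> f s + h * (c0 - e) <= f (s + h).
  move=> s0 _ e_gt0; have [F [mu [FJ _ _ FB /(_ e e_gt0)[h0 h0_gt0 h0P]]]] := f_lower s s0.
  exists h0 => // h hh; apply: le_trans (h0P h hh).
  have := trace_frame_ge k_le_n hB FJ; rewrite FB ler_pM2l // -/c0 => c0mu.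
  by case/andP: hh => h_gt0 _; rewrite lerD2l ler_pM2l // lerD2r.
have f_lb := slope_lower_bound f_mono f_slope.
have f01 : f 1 = f 0 + c0.
  rewrite /f; under eq_bigr do rewrite scale1r.
  by rewrite hsum; under [in RHS]eq_bigr do rewrite scale0r addr0.
have f_affine s t : 0 <= s -> s <= t -> t <= 1 -> f t = f s + c0 * (t - s).
  move=> s0 st t1; apply/le_anti/andP; split; last exact: f_lb.
  have := f_lb 0 s (lexx _) s0 (le_trans st t1).
  have := f_lb t 1 (le_trans s0 st) t1 (lexx _).
  by move: f01; lra.
have [s /andP[s_gt0 s1] [c /andP[sc c1] sP]] := stable_multiplicities hA hB.
have [F [mu [FJ FA [Y0 FY0] FB F_low]]] := f_lower s (ltW s_gt0).
(* [f] has slope exactly [c0] to the right of [s], which the lower bounds [mu - e] cannot exceed. *)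
have mu_le : mu <= c0.
  apply/ler_addgt0Pr => e e_gt0; have [h0 h0_gt0 h0P] := F_low e e_gt0.
  pose h := Num.min (h0 / 2) (1 - s).
  have h_gt0 : 0 < h by rewrite lt_min divr_gt0 // subr_gt0.
  have hh0 : h < h0 by rewrite gt_min; apply/orP; left; lra.
  have hs : s + h <= 1 by rewrite -lerBrDl ge_min lexx orbT.
  have := h0P h; rewrite h_gt0 hh0 => /(_ isT).
  have sh : s <= s + h by rewrite lerDl ltW.
  rewrite (f_affine s (s + h) (ltW s_gt0) sh hs) lerD2l [s + h]addrC addrK mulrC ler_pM2r //; lra.
have [YB FYB] : exists Y, sympJ *m B *m F = F *m Y.
  by apply: (@trace_eq_invariant _ _ _ k_le_n) => //; rewrite FB ler_pM2l.
have FYA : sympJ *m A *m F = F *m (Y0 - s *: YB).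
  rewrite mulmxBr -FY0 -scalemxAr -FYB mulmxDr mulmxDl -scalemxAr -scalemxAl.
  by rewrite addrK.
pose U := frame_span F.
exists 1%N, (fun=> U), (fun j => j%:R); split; split=> //.
- by move=> _; split; [exact: dim_frame_span | exact: symplectic_frame_span].
- by split=> // l; rewrite ltr_nat.
- by move=> _; split; apply: invariant_frame_span; [exact: FYA | exact: FYB].
- move=> _; have := frame_span_sympeig FJ hB FYB.
  suff -> : sympeig (F^T *m B *m F) = fun j => sympeig B (widen_ord k_le_n j) by [].
  pose d j := sympeig B (widen_ord k_le_n j); pose b j := sympeig (F^T *m B *m F) j.
  (* Interlacing gives [d j <= b j], while the [b j] sum to at most half the trace, that is
     [mu <= c0]; hence equality in every term. *)
  have db j : 0 <= b j - d j by rewrite subr_ge0; exact: le_sympeig_frame.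
  have sum_le0 : \sum_j (b j - d j) <= 0.
    rewrite sumrB subr_le0 -(ler_pM2l (ltr0Sn R 1)).
    apply: le_trans (trace_ge_sum_sympeig (posdefmx_frame hB FJ)) _.
    by rewrite FB ler_pM2l.
  apply/funext => j; apply/eqP; rewrite -subr_eq0.
  have /allP /(_ j (mem_index_enum j)) // :
    all (fun j => true ==> (b j - d j == 0)) (index_enum 'I_k).
  by rewrite -psumr_eq0 // eq_le sum_le0 sumr_ge0.
- move=> l; exists s, c; rewrite ord1; split=> //; [exact: ltW | exact: ltW |].
  move=> t stc; have /andP[st tc] := stc.
  have t_pos : posdefmx (A + t *: B) by apply: line_pos; rewrite (le_trans (ltW s_gt0)).
  split.
    by move=> j1 j2 j12; apply: sympeig_sorted => //; exact: i_mono.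
  have FYt : sympJ *m (A + t *: B) *m F = F *m (Y0 - s *: YB + t *: YB).
    rewrite [sympJ *m (_ + _)]mulmxDr mulmxDl -scalemxAr -scalemxAl FYA FYB.
    by rewrite [RHS]mulmxDr -[in RHS]scalemxAr.
  have base := frame_span_sympeig FJ t_pos FYt.
  suff <- : sympeig (F^T *m (A + t *: B) *m F) = fun j => sympeig (A + t *: B) (i j).
    exact: base.
  apply/funext => j.
  have [u [v [_ /(_ j)[[m xm] _ _ _ _]]]] := base.
  have [gap coincide] := sP t stc.
  have restrict w : F^T *m (A + w *: B) *m F = F^T *m A *m F + w *: (F^T *m B *m F).
    by rewrite mulmxDr mulmxDl -scalemxAr -scalemxAl.
  (* At [s] the [j]-th eigenvalue of the compression is the one of index [i j]. From [s] to [t] it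
     and the eigenvalue of index [m] grow by factors in [[1, t / s]] and end up equal. Distinct
     values at [s] differ by more than this factor, so the two agree at [s], and [coincide] carries
     this to [t]. *)
  have := sympeig_ray j (posdefmx_frame hA FJ) (posdefmx_frame hB FJ) s_gt0 st.
  have /andP[mx1 mx2] := sympeig_ray m hA hB s_gt0 st.
  rewrite -!restrict FA sympeig_dsum; last first.
  - by move=> j1 j2 j12; rewrite !mxE sympeig_sorted ?i_mono //; exact/line_pos/ltW.
  - by move=> l'; rewrite mxE; exact/sympeig_gt0/line_pos/ltW.
  rewrite mxE xm => /andP[jx1 jx2]; apply: coincide.
  apply/eqP; case: ltgtP => // /gap lt.
    by have := le_lt_trans mx2 (lt_le_trans lt jx1); rewrite ltxx.
  by have := le_lt_trans jx2 (lt_le_trans lt mx1); rewrite ltxx.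
Qed.
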